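(* Let $F$ be a number field of degree $n$ and discriminant $\Delta$. There is a constant $\beta$ depending only on $F$ such that for every Arakelov divisor $D$ of $F$ with $\deg(D)\le\frac12\log|\Delta|$ one has $$h^0(D)<k^0(D)-1\le\beta\,e^{-\pi n e^{-\frac{2}{n}\deg(D)}}.$$
   Context: Let $F$ be a number field with ring of integers $O_F$. The infinite primes $\sigma$ of $F$ are the real embeddings together with one chosen embedding from each pair of complex conjugate embeddings. An Arakelov divisor of $F$ is a formal finite sum $D=\sum_P x_P P+\sum_\sigma x_\sigma\sigma$, with $P$ running over the nonzero prime ideals of $O_F$, $\sigma$ over the infinite primes, $x_P\in\mathbb{Z}$ (almost all zero) and $x_\sigma\in\mathbb{R}$. The degree is $\deg(D)=\sum_P \log(\#(O_F/P))\,x_P+\sum_\sigma x_\sigma$. The fractional ideal associated to $D$ is $I=\prod_P P^{-x_P}$. For $f\in F$ put $$\|f\|_D^2=\sum_{\sigma\text{ real}}|\sigma(f)|^2e^{-2x_\sigma}+\sum_{\sigma\text{ complex}}2|\sigma(f)|^2e^{-x_\sigma}.$$ Put $k^0(D)=\sum_{f\in I}e^{-\pi\|f\|_D^2}$ and $h^0(D)=\log k^0(D)$. *)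

(* Defs.v *)
From HB Require Import structures.
From mathcomp Require Import all_boot all_order all_algebra all_field.
From mathcomp Require Import all_classical all_reals all_analysis.
From mathcomp Require Import complex finmap.

Set Implicit Arguments.
Unset Strict Implicit.
Unset Printing Implicit Defensive.

Import Order.TTheory GRing.Theory Num.Theory.

Local Open Scope classical_set_scope.
Local Open Scope ring_scope.

(* A number field is a [F : fieldExtType rat]; its degree is [\dim {:F}].
   Ideals and fractional ideals of its ring of integers are sets of elements
   of F. *)

Section NumberField.
Variable F : fieldExtType rat.

Definition integers : set F := [set x | integralOver (intr : int -> F) x].

Definition trace (x : F) : rat :=
  \tr (passmx.mxof (vbasis {:F}) (vbasis {:F}) (amulr x)).

Definition integral_basis (b : (\dim {:F}).-tuple F) : Prop :=
  basis_of {:F} b /\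
  integers = [set x | exists c : 'I_(\dim {:F}) -> int,
                        x = \sum_i (c i)%:~R * tnth b i].

(* All integral bases give the same value, since the base change has
   determinant 1 or -1; one of them is selected by choice. *)
Definition discriminant : rat :=
  xget 0 [set d | exists2 b, integral_basis b &
    d = \det (\matrix_(i, j) trace (tnth b i * tnth b j))].

Definition is_ideal (P : set F) : Prop :=
  [/\ P `<=` integers, P 0,
      forall x y, P x -> P y -> P (x + y)
    & forall a x, integers a -> P x -> P (a * x)].

Definition is_prime_ideal (P : set F) : Prop :=
  [/\ is_ideal P, ~ P 1
    & forall x y, integers x -> integers y -> P (x * y) -> P x \/ P y].

Definition prime_ideals : set (set F) :=
  [set P | is_prime_ideal P /\ P <> [set 0]].

Definition residue_classes (P : set F) : set (set F) :=
  [set [set x + y | y in P] | x in integers].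

(* #(O_F / P) (a finite number for every nonzero ideal P) *)
Definition ideal_norm (P : set F) : nat :=
  #|` fset_set (residue_classes P)|%fset.

Definition mul_ideal (A B : set F) : set F :=
  [set x | exists2 s : seq (F * F),
    (forall p, p \in s -> A p.1 /\ B p.2) & x = \sum_(p <- s) p.1 * p.2].

Definition inv_ideal (A : set F) : set F :=
  [set x | forall a, A a -> integers (x * a)].

Definition pow_ideal (A : set F) (m : int) : set F :=
  match m with
  | Posz k => iter k (mul_ideal A) integers
  | Negz k => iter k.+1 (mul_ideal (inv_ideal A)) integers
  end.

End NumberField.

Arguments integers : clear implicits.
Arguments prime_ideals : clear implicits.

Section Arakelov.
Variables (R : realType) (F : fieldExtType rat).

Definition embeddings : set (F -> R[i]) :=
  [set s | GRing.zmod_morphism s /\ GRing.monoid_morphism s].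

Definition is_real_embedding (s : F -> R[i]) : Prop :=
  forall x, complex.Im (s x) = 0.

Definition real_embeddings : set (F -> R[i]) :=
  [set s | embeddings s /\ is_real_embedding s].

Definition complex_embeddings : set (F -> R[i]) :=
  [set s | embeddings s /\ ~ is_real_embedding s].

(* A choice of one embedding out of each pair {s, conj s} of complex conjugate
   embeddings. *)
Record conjugate_choice := ConjugateChoice {
  chosen :> set (F -> R[i]);
  chosen_complex : chosen `<=` complex_embeddings;
  chosen_conj : forall s, complex_embeddings s ->
    (chosen s <-> ~ chosen (fun x => conjc (s x)))
}.

Definition infinite_primes (C : conjugate_choice) : set (F -> R[i]) :=
  real_embeddings `|` chosen C.

Record arakelov_divisor (C : conjugate_choice) := ArakelovDivisor {
  fin_coef : prime_ideals F -> int;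
  fin_coef_finite : finite_set [set P | fin_coef P != 0];
  inf_coef : infinite_primes C -> R
}.

Variables (C : conjugate_choice) (D : arakelov_divisor C).

Definition degree : R :=
  \sum_(P \in [set: prime_ideals F])
     ln ((ideal_norm (val P))%:R : R) * (fin_coef D P)%:~R
  + \sum_(s \in [set: infinite_primes C]) inf_coef D s.

Definition divisor_ideal : set F :=
  \big[@mul_ideal F/integers F]_(P <- fset_set [set P | fin_coef D P != 0])
     pow_ideal (val P) (- fin_coef D P).

(* [Normc.normc] is the R-valued absolute value on R[i]. *)
Definition sqnorm (f : F) : R :=
  \sum_(s \in [set s : infinite_primes C | is_real_embedding (val s)])
     Normc.normc (val s f) ^+ 2 * expR (- (2 * inf_coef D s))
  + \sum_(s \in [set s : infinite_primes C | ~ is_real_embedding (val s)])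
     2 * Normc.normc (val s f) ^+ 2 * expR (- inf_coef D s).

(* Infinite sums of nonnegative terms are taken in the extended reals, so that
   convergence is part of any finite upper bound on [k0]. *)
Definition k0 : \bar R :=
  \esum_(f in divisor_ideal) (expR (- (pi * sqnorm f)))%:E.

Definition h0 : \bar R := lne k0.

End Arakelov.

(* Main.v *)
(* For nonzero f in the ideal I of D, AM-GM applied to the n embeddings of F in
   R[i] gives |f|_D^2 >= n (|N(f)| e^(- sum x_sigma))^(2/n), and
   |N(f)| >= N(I) = prod N(P)^(- x_P), so that |f|_D^2 >= l(deg D) with
   l(d) = n e^(- 2 d / n).  Scaled by 1 / sqrt(l(deg D)), the nonzero points of I
   are therefore at mutual distance at least 1, and a grid of small cubes bounds
   sum exp(- pi l(d0) |v|^2) over them by a constant depending only on n and on the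
   bound d0 >= deg D.  As l(deg D) >= l(d0), the factor exp(- pi l(deg D)) splits
   off.  Neither the finiteness of the class number nor the unit theorem is needed.

   The inequality |N(f)| >= N(I) is a comparison of indices.  Write
   J = prod P^(x_P) over x_P > 0 and K = prod P^(- x_P) over x_P < 0, so that
   f J lies in K.  For A a product of nonzero primes, [A : P A] = N(P); this rests
   on the invertibility of P in the form: p q - 1 lies in P for some p in P and
   some q in F with q P inside O.  Together with [O : g O] = |N(g)|, read off the
   lattice Z[theta] by the Smith normal form, this bounds both sides. *)

Require Import Defs.
From HB Require Import structures.
From mathcomp Require Import all_boot all_order all_algebra all_field.
From mathcomp Require Import all_classical all_reals all_analysis.
From mathcomp Require Import complex finmap ring lra.

Set Implicit Arguments.
Unset Strict Implicit.
Unset Printing Implicit Defensive.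

Import Order.TTheory GRing.Theory Num.Theory.

Local Open Scope ring_scope.

(** * Indices of subgroups *)

Section SubgroupIndex.
Local Open Scope classical_set_scope.
Variable V : zmodType.
Implicit Types (A B C : set V) (m k : nat).

(** Bounds on the index [A : B] without a quotient group: from above by a labelling of A that
    separates the classes modulo B, from below ([index_ge]) by a family of pairwise incongruent
    elements of A. *)
Definition index_le A B m :=
  exists (T : finType) (phi : V -> T), (#|T| <= m)%N /\
    forall x y, A x -> A y -> phi x = phi y -> B (x - y).

Definition index_ge A B m :=
  exists (T : finType) (s : T -> V), [/\ (m <= #|T|)%N, forall t, A (s t)
    & forall t u, B (s t - s u) -> t = u].

Definition subgroup A := A 0 /\ forall x y, A x -> A y -> A (x - y).

Lemma subgroupN A x : subgroup A -> A x -> A (- x).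
Proof. by case=> A0 AB Ax; rewrite -sub0r; exact: AB. Qed.

Lemma subgroupD A x y : subgroup A -> A x -> A y -> A (x + y).
Proof.
move=> sgA Ax Ay; rewrite -[y]opprK; apply: sgA.2 => //; exact: subgroupN.
Qed.

Lemma subgroup_sum A (I : Type) (r : seq I) (P : pred I) (f : I -> V) :
  subgroup A -> (forall i, P i -> A (f i)) -> A (\sum_(i <- r | P i) f i).
Proof.
move=> sgA Af; apply: big_rec => [|i x Pi Ax]; first exact: sgA.1.
by apply: subgroupD => //; exact: Af.
Qed.

Lemma index_ge_le A B m k : index_ge A B m -> index_le A B k -> (m <= k)%N.
Proof.
move=> [T [s [mT sA sinj]]] [U [phi [kU phiP]]].
apply: leq_trans mT (leq_trans _ kU).
by apply: (@leq_card _ _ (phi \o s)) => t u /= e; apply: sinj; apply: phiP.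
Qed.

Lemma index_leS A B A' B' m :
  A' `<=` A -> B `<=` B' -> index_le A B m -> index_le A' B' m.
Proof.
move=> sA sB [U [phi [kU phiP]]]; exists U, phi; split => // x y Ax Ay e.
by apply/sB/phiP => //; apply: sA.
Qed.

(** An element of A receives its label modulo B together with the label modulo C of its difference
    from a fixed representative with the same first label. *)
Lemma index_le_trans A B C m k :
  index_le A B m -> index_le B C k -> index_le A C (m * k).
Proof.
move=> [T [phi [mT phiP]]] [U [psi [kU psiP]]].
have [rep repP] : {rep : T -> V & forall t x, A x -> phi x = t ->
    A (rep t) /\ phi (rep t) = t}.
  apply: (@choice _ _ (fun t r => forall x, A x -> phi x = t ->
    A r /\ phi r = t)) => t.
  have [[x [Ax xt]]|nx] := pselect (exists x, A x /\ phi x = t).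
    by exists x.
  by exists 0 => x Ax xt; case: nx; exists x.
exists (T * U)%type, (fun x => (phi x, psi (x - rep (phi x)))).
split; first by rewrite card_prod leq_mul.
move=> x y Ax Ay [e1]; rewrite e1 => e2.
have [Ar er] := repP _ _ Ay erefl.
have -> : x - y = (x - rep (phi y)) - (y - rep (phi y)).
  by rewrite opprB addrA subrK.
by apply: psiP => //; apply: phiP => //; rewrite er.
Qed.

(** The witnesses are sums of a member of each family. A difference of two sums that lies in C also
    lies in B, which identifies the first summands and then the second ones. *)
Lemma index_ge_trans A B C m k : subgroup A -> subgroup B -> B `<=` A ->
  C `<=` B -> index_ge A B m -> index_ge B C k -> index_ge A C (m * k).
Proof.
move=> sgA sgB BA CB [T [s [mT sA sinj]]] [U [r [kU rA rinj]]].
exists (T * U)%type, (fun p => s p.1 + r p.2); split.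
- by rewrite card_prod leq_mul.
- by move=> [t u] /=; apply: subgroupD => //; exact: BA.
move=> [t u] [t' u'] /=; rewrite opprD addrACA => Ctu.
have ett : t = t'.
  apply: sinj; rewrite -[_ - _](addrK (r u - r u')).
  by apply: sgB.2; [exact: CB|exact: sgB.2].
rewrite ett subrr add0r in Ctu.
by rewrite ett (rinj _ _ Ctu).
Qed.

(* A maximal B-separated family of A is a system of representatives. *)
Lemma index_exact A B m : A 0 -> subgroup B -> index_le A B m ->
  exists c, index_le A B c /\ index_ge A B c.
Proof.
move=> A0 sgB Am.
pose P := fun c => `[< index_ge A B c >].
have exP : exists c, P c.
  by exists 0%N; apply/asboolP; exists 'I_0, (fun=> 0); split => // -[].
have ubP c : P c -> (c <= m)%N by move/asboolP/index_ge_le; apply.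
have [c /asboolP gec maxc] := ex_maxnP exP ubP.
exists c; split => //; case: gec => [T [s [cT sA sinj]]].
have cov x : A x -> exists t, B (x - s t).
  move=> Ax; apply: contrapT => nx.
  suff /asboolP/maxc : index_ge A B c.+1 by rewrite ltnn.
  exists (option T), (fun o => if o is Some t then s t else x); split.
  - by rewrite card_option ltnS.
  - by case.
  move=> [t|] [u|] // Btu.
  - by rewrite (sinj _ _ Btu).
  - by case: nx; exists t; rewrite -opprB; apply: subgroupN.
  - by case: nx; exists u.
have [t0 _] := cov _ A0.
have [phi phiP] : {phi : V -> T & forall x, A x -> B (x - s (phi x))}.
  apply: (@choice _ _ (fun x t => A x -> B (x - s t))) => x.
  have [/cov[t]|] := pselect (A x); first by exists t.
  by exists t0.
exists T, phi; split.
  by apply: maxc; apply/asboolP; exists T, s; split.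
move=> x y Ax Ay e; have := sgB.2 _ _ (phiP _ Ax) (phiP _ Ay).
by rewrite e opprB addrA subrK.
Qed.

End SubgroupIndex.

(** * Indices under multiplication by a nonzero field element *)

Section ScaledIndex.
Local Open Scope classical_set_scope.
Variable F : fieldType.
Implicit Types (A B : set F) (g : F).

Definition scale_set g A : set F := [set g * x | x in A].

Lemma scale_setP g A x : g != 0 -> scale_set g A x <-> A (g^-1 * x).
Proof.
move=> g0; split => [[y Ay <-]|Ax]; first by rewrite mulKf.
by exists (g^-1 * x) => //; rewrite mulVKf.
Qed.

Lemma scale_setS g A B : A `<=` B -> scale_set g A `<=` scale_set g B.
Proof. by move=> AB _ [x Ax <-]; exists x => //; exact: AB. Qed.

Lemma subgroup_scale g A : subgroup A -> subgroup (scale_set g A).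
Proof.
move=> sgA; split; first by exists 0; rewrite ?mulr0 //; exact: sgA.1.
move=> _ _ [x Ax <-] [y Ay <-].
by exists (x - y); rewrite ?mulrBr //; exact: sgA.2.
Qed.

Lemma index_le_scale g A B m : g != 0 ->
  index_le A B m -> index_le (scale_set g A) (scale_set g B) m.
Proof.
move=> g0 [U [phi [kU phiP]]]; exists U, (fun x => phi (g^-1 * x)); split => //.
move=> x y /scale_setP Ax /scale_setP Ay e; apply/scale_setP => //.
by rewrite mulrBr; apply: phiP => //; [exact: Ax|exact: Ay].
Qed.

Lemma index_ge_scale g A B m : g != 0 ->
  index_ge A B m -> index_ge (scale_set g A) (scale_set g B) m.
Proof.
move=> g0 [T [s [kT sA sinj]]]; exists T, (fun t => g * s t); split => //.
  by move=> t; exists (s t).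
by move=> t u; rewrite -mulrBr => /scale_setP; rewrite mulKf // => /(_ g0)/sinj.
Qed.

End ScaledIndex.

(** * Embeddings and the power basis of an integral primitive element *)

Lemma common_denominator (I : finType) (a : I -> rat) :
  exists2 d : nat, (0 < d)%N & forall i, d%:R * a i \is a Num.int.
Proof.
exists (\prod_i `|denq (a i)|)%N => [|i].
  by apply: prodn_gt0 => i; rewrite absz_gt0 denq_neq0.
rewrite (bigD1 i) //= natrM mulrAC natr_absz ger0_norm ?denq_ge0 //.
rewrite rpredM ?rpred_nat // mulrC.
by rewrite -numqE intr_int.
Qed.

Section PowerBasis.
Variable F : fieldExtType rat.
Notation O := (integers F).
Notation n := (\dim {:F}).
Implicit Types x y : F.

Lemma integers0 : O 0. Proof. exact: mxpoly.integral0. Qed.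

Lemma integers1 : O 1. Proof. exact: mxpoly.integral1. Qed.

Lemma integersB x y : O x -> O y -> O (x - y). Proof. exact: integral_sub. Qed.

Lemma integersD x y : O x -> O y -> O (x + y). Proof. exact: integral_add. Qed.

Lemma integersM x y : O x -> O y -> O (x * y).
Proof. exact: integral_mul. Qed.

Lemma integersX x k : O x -> O (x ^+ k).
Proof.
move=> Ox; elim: k => [|k IH]; first exact: integers1.
by rewrite exprS; apply: integersM.
Qed.

Lemma integers_nat (m : nat) : O m%:R. Proof. exact: integral_nat. Qed.

Lemma integers_int (z : int) : O z%:~R.
Proof. exact: (integral_id (intr : {rmorphism int -> F})). Qed.

Lemma subgroup_integers : subgroup O.
Proof. by split; [exact: integers0|move=> x y; exact: integersB]. Qed.

(** If x is a root of the monic p of degree m and d clears the denominators of p, then dx is a root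
    of d^m p(X/d), which is monic with integral coefficients. *)
Lemma integral_multiple (x : F) : exists2 d : nat, (0 < d)%N & O (d%:R * x).
Proof.
have /polyOver1P[p pE] := minPolyOver 1 x.
have monp : p \is monic by rewrite -(map_monic (in_alg F)) -pE monic_minPoly.
have [d d0 dP] := common_denominator (fun i : 'I_(size p) => p`_i).
exists d => //; set m := (size p).-1.
have sm : size p = m.+1.
  by rewrite prednK // size_poly_gt0 monic_neq0.
pose P : {poly F} := \poly_(i < m.+1) (d%:R ^+ (m - i) * (p`_i)%:A).
have Pm : P`_m = 1.
  rewrite coef_poly ltnSn subnn expr0 mul1r.
  by rewrite (_ : p`_m = 1) ?scale1r //; exact/monicP.
have sP : size P = m.+1.
  apply/anti_leq; rewrite size_poly /= ltnNge; apply/negP => /leq_sizeP/(_ m).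
  by rewrite leqnn Pm => /(_ isT)/eqP; rewrite oner_eq0.
apply: (@integral_root_monic _ _ (intr : int -> F) _ P).
- by rewrite monicE lead_coefE sP Pm.
- rewrite rootE horner_poly (_ : \sum_(i < _) _ = d%:R ^+ m * (minPoly 1 x).[x]).
    by rewrite minPolyxx mulr0.
  rewrite pE horner_coef size_map_poly sm mulr_sumr; apply: eq_bigr => i _.
  rewrite coef_map /= exprMn -[X in d%:R ^+ X * (_ * _)](subnK (ltnSE (ltn_ord i))).
  by rewrite exprD !mulrA; congr (_ * _); rewrite mulrAC.
move=> _ /(nthP 0)[i + <-]; rewrite sP => im; rewrite coef_poly im.
have [->|im'] := eqVneq i m.
  rewrite subnn expr0 mul1r (_ : p`_m = 1) ?scale1r; last exact/monicP.
  exact: integers1.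
have ip : (i < size p)%N by rewrite sm.
rewrite -(subnSK (_ : i < m)%N) ?exprSr -?mulrA; last first.
  by rewrite ltn_neqAle im' -ltnS.
apply: integersM; first by rewrite -natrX; exact: integers_nat.
rewrite -[d%:R]scaler_nat -[_ *: 1]/(_%:A) -in_algE -in_algE -rmorphM /=.
have /intrP[z ->] := dP (Ordinal ip).
rewrite /= -in_algE rmorph_int; exact: integers_int.
Qed.

(** The primitive element theorem, followed by multiplication by a positive integer that makes the
    generator integral and leaves the generated field unchanged. *)
Lemma ex_primitive : exists x : F, O x /\ <<1; x>>%VS = fullv.
Proof.
have sep : separable 1 {:F}.
  apply/separableP => y _; apply: pcharf0_separable.
  move=> q; rewrite !inE /=; apply/negP => /andP[/prime_gt0 q0].
  rewrite -(rmorph_nat (in_alg F)) fmorph_eq0 pnatr_eq0 => /eqP q0'.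
  by rewrite q0' in q0.
have := eq_adjoin_separable_generator sep (sub1v _).
set z := separable_generator _ _ => zE.
have [d d0 Od] := integral_multiple z; exists (d%:R * z); split => //.
apply/eqP; rewrite eqEsubv subvf /= [X in (X <= _)%VS]zE.
apply/FadjoinP; split; first exact: sub1v.
have zd : z = d%:R^-1 *: (d%:R * z).
  by rewrite -scaler_nat -scalerAl mul1r scalerA mulVf ?scale1r // pnatr_eq0 -lt0n.
by rewrite [X in X \in _]zd memvZ // memv_adjoin.
Qed.

Definition primitive : F := xget 0 [set x | O x /\ <<1; x>>%VS = fullv].

Lemma primitiveP : O primitive /\ <<1; primitive>>%VS = fullv.
Proof. exact: (xgetPex 0 ex_primitive). Qed.

Definition power_basis : n.-tuple F := [tuple primitive ^+ i | i < n].

Lemma size_minPoly_primitive : size (minPoly 1 primitive) = n.+1.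
Proof.
rewrite size_minPoly; congr S; have := dim_Fadjoin 1 primitive.
by rewrite primitiveP.2 dimv1 muln1 => ->.
Qed.

Lemma power_basisE (i : 'I_n) : power_basis`_i = primitive ^+ i.
Proof. by rewrite -tnth_nth tnth_mktuple. Qed.

(** A linear relation would be a nonzero polynomial of degree below n vanishing at [primitive],
    whose minimal polynomial has degree n. *)
Lemma power_basisP : basis_of {:F} power_basis.
Proof.
rewrite basisEfree subvf size_tuple leqnn !andbT; apply/freeP => k.
under eq_bigr => i _ do rewrite power_basisE.
move=> k0; pose p : {poly rat} := \poly_(i < n) (if insub i is Some j then k j else 0).
have pk (i : 'I_n) : p`_i = k i by rewrite coef_poly ltn_ord valK.
suff p0 : p = 0 by move=> i; rewrite -pk p0 coef0.
apply/eqP; rewrite -(map_poly_eq0 (in_alg F)); apply/eqP.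
have : (size (map_poly (in_alg F) p) < size (minPoly 1 primitive))%N.
  by rewrite size_map_poly size_minPoly_primitive ltnS size_poly.
apply: contraTeq => p0; rewrite -leqNgt; apply: dvdp_leq => //.
apply: minPoly_dvdp; first by apply/polyOver1P; exists p.
have sp : (size (map_poly (in_alg F) p) <= n)%N by rewrite size_map_poly size_poly.
rewrite rootE (horner_coef_wide _ sp) -[X in _ == X]k0; apply/eqP.
by apply: eq_bigr => i _; rewrite coef_map /= pk mulr_algl.
Qed.

Definition coords (x : F) : 'rV[rat]_n := \row_i coord power_basis i x.

Lemma coords_eq x : x = \sum_i coords x 0 i *: primitive ^+ i.
Proof.
rewrite [LHS](coord_basis power_basisP (memvf x)).
by apply: eq_bigr => i _; rewrite mxE power_basisE.
Qed.

Fact coords_is_linear : linear coords.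
Proof. by move=> a x y; apply/rowP => i; rewrite !mxE linearP. Qed.

HB.instance Definition _ := GRing.isLinear.Build rat F 'rV[rat]_n _ coords
  coords_is_linear.

Lemma coordsB x y i : coords (x - y) 0 i = coords x 0 i - coords y 0 i.
Proof. by rewrite linearB !mxE. Qed.

Lemma coords_power (i : 'I_n) : coords (primitive ^+ i) = delta_mx 0 i.
Proof.
apply/rowP => j; rewrite !mxE eqxx /= -power_basisE.
by rewrite coord_free ?(basis_free power_basisP) // eq_sym.
Qed.

Lemma coords_sum (u : 'rV[rat]_n) : coords (\sum_i u 0 i *: primitive ^+ i) = u.
Proof.
rewrite linear_sum; under eq_bigr => i _ do rewrite linearZ /= coords_power.
by rewrite -row_sum_delta.
Qed.

Lemma coords_inj : injective coords.
Proof. by move=> x y e; rewrite (coords_eq x) e -coords_eq. Qed.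

(** Multiplication by x, acting from the right on row vectors of coordinates. *)
Definition mulmat (x : F) : 'M[rat]_n := \matrix_i coords (x * primitive ^+ i).

Definition norm (x : F) : rat := \det (mulmat x).

Lemma coordsM x y : coords (x * y) = coords y *m mulmat x.
Proof.
rewrite {1}(coords_eq y) mulr_sumr linear_sum mulmx_sum_row.
by apply: eq_bigr => i _; rewrite rowK -scalerAr linearZ.
Qed.

Lemma mulmatZ (a : rat) x : mulmat (a *: x) = a *: mulmat x.
Proof.
by apply/row_matrixP => i; rewrite rowK -scalerAl linearZ [RHS]linearZ /= rowK.
Qed.

(** * The n embeddings into an algebraically closed field *)

Section Roots.
Variable K : numClosedFieldType.

(** The roots of the minimal polynomial are distinct by separability. Describing them as the common
    zeros of all rational polynomials that vanish at [primitive] makes evaluation at a conjugate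
    well defined. *)
Lemma minPoly_primitive_roots : exists r : n.-tuple K, uniq r /\
  forall z, z \in r <-> forall p : {poly rat},
    root (map_poly (in_alg F) p) primitive -> root (map_poly ratr p) z.
Proof.
have /polyOver1P[q qE] := minPolyOver 1 primitive.
have sepq : separable_poly q.
  rewrite -(separable_map (in_alg F)) -qE; apply: pcharf0_separable => l.
  rewrite !inE; apply/negP => /andP[/prime_gt0 l0].
  rewrite -(rmorph_nat (in_alg F)) fmorph_eq0 pnatr_eq0 => /eqP l0'.
  by rewrite l0' in l0.
have q0 : q != 0.
  by rewrite -(map_poly_eq0 (in_alg F)) -qE monic_neq0 // monic_minPoly.
have [r rE] := closed_field_poly_normal (map_poly (ratr : rat -> K) q).
have l0 : lead_coef (map_poly (ratr : rat -> K) q) != 0.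
  by rewrite lead_coef_eq0 map_poly_eq0.
have sr : size r == n.
  have := congr1 (fun p : {poly K} => size p) rE.
  rewrite size_map_poly size_scale // size_prod_XsubC -(size_map_poly (in_alg F)) -qE.
  by rewrite size_minPoly_primitive => -[->].
exists (Tuple sr); split.
  rewrite -separable_prod_XsubC -(eqp_separable (eqp_scale _ l0)) -rE.
  by rewrite separable_map.
move=> z; split=> [zr p rp|rz]; last first.
  have : root (map_poly (in_alg F) q) primitive by rewrite -qE root_minPoly.
  by move/rz; rewrite rE rootZ // root_prod_XsubC.
suff /dvdpP[s ->] : q %| p 
  by rewrite rmorphM rootM /= [X in _ || root X _]rE rootZ // root_prod_XsubC zr orbT.
rewrite -(dvdp_map (in_alg F)) -qE; apply: minPoly_dvdp => //.
by apply/polyOver1P; exists p.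
Qed.

Definition conjugates : n.-tuple K := sval (cid minPoly_primitive_roots).

Lemma conjugatesP z : z \in conjugates <-> forall p : {poly rat},
  root (map_poly (in_alg F) p) primitive -> root (map_poly ratr p) z.
Proof. by rewrite /conjugates; case: cid => r []. Qed.

Definition embedding (j : 'I_n) (x : F) : K :=
  \sum_i ratr (coords x 0 i) * tnth conjugates j ^+ i.

Lemma conjugates_inj : injective (tnth conjugates).
Proof. by apply/tuple_uniqP; rewrite /conjugates; case: cid => r []. Qed.

(** The polynomial p and the coordinate polynomial c agree at [primitive], so their difference
    vanishes at every conjugate. Multiplicativity of [embedding] comes from this. *)
Lemma embedding_horner (p : {poly rat}) j :
  embedding j (map_poly (in_alg F) p).[primitive] =
  (map_poly ratr p).[tnth conjugates j].
Proof.
set x := _.[primitive]; rewrite /embedding.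
pose c := \poly_(i < n) (if insub i is Some i then coords x 0 i else 0).
have cE (i : 'I_n) : c`_i = coords x 0 i by rewrite coef_poly ltn_ord valK.
have sc : (size c <= n)%N by exact: size_poly.
have -> : \sum_i ratr (coords x 0 i) * tnth conjugates j ^+ i =
    (map_poly ratr c).[tnth conjugates j].
  rewrite (@horner_coef_wide _ n) ?size_map_poly //.
  by apply: eq_bigr => i _; rewrite coef_map /= cE.
apply/eqP; rewrite -subr_eq0 -hornerN -hornerD -rmorphB -rootE.
apply: (conjugatesP _).1 (mem_tnth j conjugates) _ _.
rewrite rootE rmorphB /= hornerD hornerN subr_eq0 -/x.
rewrite (@horner_coef_wide _ n) ?size_map_poly //; apply/eqP.
by rewrite [RHS]coords_eq; apply: eq_bigr => i _; rewrite coef_map /= cE mulr_algl.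
Qed.

Lemma horner_ex x : exists p : {poly rat}, x = (map_poly (in_alg F) p).[primitive].
Proof.
exists (\sum_i coords x 0 i *: 'X^i).
rewrite [LHS]coords_eq rmorph_sum horner_sum; apply: eq_bigr => i _.
by rewrite /= linearZ_LR /= map_polyXn hornerZ hornerXn mulr_algl.
Qed.

Lemma embedding_zmod_morphism j : zmod_morphism (embedding j).
Proof.
move=> x y; rewrite /embedding -sumrB; apply: eq_bigr => i _.
by rewrite linearB !mxE rmorphB mulrBl.
Qed.

Lemma embedding_monoid_morphism j : monoid_morphism (embedding j).
Proof.
split=> [|x y].
  by have := embedding_horner 1 j; rewrite !rmorph1 !hornerE.
have [p ->] := horner_ex x; have [q ->] := horner_ex y.
by rewrite -hornerM -rmorphM !embedding_horner rmorphM hornerM.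
Qed.

HB.instance Definition _ j :=
  GRing.isZmodMorphism.Build F K (embedding j) (embedding_zmod_morphism j).
HB.instance Definition _ j :=
  GRing.isMonoidMorphism.Build F K (embedding j) (embedding_monoid_morphism j).

Lemma embedding_primitive j : embedding j primitive = tnth conjugates j.
Proof.
by have := embedding_horner 'X j; rewrite !map_polyX !hornerX.
Qed.

Lemma embedding_inj : injective embedding.
Proof.
by move=> i j e; apply: conjugates_inj; rewrite -!embedding_primitive e.
Qed.

(** A ring morphism fixes the rationals, so it is determined by the image of [primitive], which must
    be a conjugate. *)
Lemma embeddings_complete (s : {rmorphism F -> K}) : exists j, s =1 embedding j.
Proof.
have sE (p : {poly rat}) (x : F) :
    s (map_poly (in_alg F) p).[x] = (map_poly ratr p).[s x].
  rewrite -horner_map -map_poly_comp; congr (_.[_]); apply: eq_map_poly => a /=.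
  by rewrite -(fmorph_eq_rat (s \o in_alg F)).
have : exists j, tnth conjugates j = s primitive.
  suff /tnthP[j ->] : s primitive \in conjugates by exists j.
  apply/conjugatesP => p /rootP rp.
  by rewrite rootE -sE rp rmorph0.
move=> [j jE]; exists j => x; have [p ->] := horner_ex x.
by rewrite embedding_horner sE jE.
Qed.

Definition vandermonde : 'M[K]_n :=
  \matrix_(i, j) tnth conjugates j ^+ i.

Lemma det_vandermonde_neq0 : \det vandermonde != 0.
Proof.
rewrite (_ : vandermonde = Vandermonde n (\row_j tnth conjugates j)); last first.
  by apply/matrixP => i j; rewrite !mxE.
rewrite det_Vandermonde prodf_seq_neq0; apply/allP => i _ /=.
rewrite prodf_seq_neq0; apply/allP => j _; apply/implyP => ij; rewrite !mxE.
by rewrite subr_eq0 (inj_eq conjugates_inj) -val_eqE gtn_eqF.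
Qed.

Lemma coords_embedding x :
  map_mx ratr (coords x) *m vandermonde = \row_j embedding j x.
Proof. by apply/rowP => j; rewrite !mxE; apply: eq_bigr => i _; rewrite !mxE. Qed.

(** The Vandermonde matrix diagonalises multiplication by x; norm and trace are then the product and
    the sum of the embeddings. *)
Lemma mulmat_embedding x : map_mx ratr (mulmat x) *m vandermonde =
  vandermonde *m diag_mx (\row_j embedding j x).
Proof.
apply/row_matrixP => i; rewrite !row_mul -map_row rowK coords_embedding.
apply/rowP => j; rewrite mul_mx_diag !mxE rmorphM mulrC; congr (_ * _).
by rewrite rmorphXn /= embedding_primitive.
Qed.

Lemma norm_embedding x : ratr (norm x) = \prod_j embedding j x.
Proof.
have := congr1 determinant (mulmat_embedding x).
rewrite !det_mulmx det_map_mx det_diag mulrC => /(mulfI det_vandermonde_neq0) ->.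
by apply: eq_bigr => j _; rewrite mxE.
Qed.

Lemma trace_embedding x : ratr (\tr (mulmat x)) = \sum_j embedding j x.
Proof.
have Vu : vandermonde \in unitmx by rewrite unitmxE unitfE det_vandermonde_neq0.
rewrite -trace_map_mx -[map_mx _ _](mulmxK Vu) mulmat_embedding mxtrace_mulC.
rewrite mulmxA mulVmx // mul1mx mxtrace_diag.
by apply: eq_bigr => j _; rewrite mxE.
Qed.

End Roots.

End PowerBasis.

Arguments integers0 {F}.
Arguments integers1 {F}.
Arguments subgroup_integers {F}.

(** * The lattice spanned by the power basis *)

Lemma int_mxP k l (A : 'M[rat]_(k, l)) : (forall i j, A i j \is a Num.int) ->
  exists B : 'M[int]_(k, l), A = map_mx intr B.
Proof.
move=> Aint; exists (map_mx Num.floor A).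
by apply/matrixP => i j; rewrite !mxE floorK.
Qed.

(* By the Smith normal form, Z^k / Z^k A is a product of cyclic groups. *)
Lemma int_row_index k (A : 'M[int]_k) : \det A != 0 ->
  exists (T : finType) (phi : 'rV[int]_k -> T), (#|T| <= `|\det A|)%N /\
    forall u v, phi u = phi v -> exists w, u - v = w *m A.
Proof.
have [L Lu [U Uu [d _ AE]]] := int_Smith_normal_form A.
have dE : (\matrix_(i, j) (d`_i *+ (i == j :> nat)) : 'M[int]_k) = diag_mx (\row_i d`_i).
  by apply/matrixP => i j; rewrite !mxE.
rewrite dE in AE; have detA : `|\det A|%N = (\prod_(i < k) absz (d`_i)%R)%N.
  have unit1 (B : 'M[int]_k) : B \in unitmx -> `|\det B|%N = 1%N.
    by rewrite unitmxE => /orP[] /eqP ->.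
  rewrite AE !det_mulmx det_diag !abszM unit1 // unit1 // mul1n muln1.
  rewrite (big_morph absz abszM absz1); apply: eq_bigr => i _; by rewrite mxE.
move=> A0; have d0 (i : 'I_k) : d`_i != 0.
  by apply: contra_neq A0 => di; apply/eqP; rewrite -absz_eq0 detA (bigD1 i) //= di.
have dlt (i : 'I_k) z : (`|(z %% d`_i)%Z| < absz (d`_i)%R)%N.
  by rewrite -ltz_nat gez0_abs ?modz_ge0 // ltz_mod.
(* As A = L diag(d) U, the label of u consists of the entries of u U^-1 modulo the d_i. *)
pose phi (u : 'rV[int]_k) : fprod (fun i : 'I_k => 'I_(absz d`_i)) :=
  [fprod i => Ordinal (dlt i ((u *m invmx U) 0 i))].
exists (fprod (fun i : 'I_k => 'I_(absz d`_i))), phi; split.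
  by rewrite card_fprod detA; apply: leq_prod => i _; rewrite card_ord.
move=> u v e; pose z := (u - v) *m invmx U.
have zd (i : 'I_k) : (d`_i %| z 0%R i)%Z.
  have := congr1 (fun p : fprod _ => val (p i)) e; rewrite !fprodE /= => ei.
  rewrite /z mulmxBl mxE [X in _ + X]mxE -eqz_mod_dvd; apply/eqP.
  by rewrite -[LHS]gez0_abs ?modz_ge0 // -[RHS]gez0_abs ?modz_ge0 // ei.
have -> : u - v = z *m U by rewrite mulmxKV.
clearbody z; exists ((\row_i (z 0%R i %/ d`_i)%Z) *m invmx L).
rewrite AE !mulmxA mulmxKV //; congr (_ *m _).
by apply/rowP => i; rewrite mul_mx_diag !mxE divzK.
Qed.

Section Lattice.
Local Open Scope classical_set_scope.
Variable F : fieldExtType rat.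
Implicit Types x y g : F.
Notation O := (integers F).
Notation n := (\dim {:F}).
Notation theta := (primitive F).

(** The order Z[theta], an explicit lattice of finite index in O. *)
Definition lattice : set F := [set x | forall i, coords x 0 i \is a Num.int].

Lemma subgroup_lattice : subgroup lattice.
Proof.
split=> [i|x y Lx Ly i]; first by rewrite linear0 mxE.
by rewrite coordsB rpredB.
Qed.

Lemma integers_primitiveX (i : nat) : O (theta ^+ i).
Proof. exact/integersX/(primitiveP F).1. Qed.

Lemma lattice_integers : lattice `<=` O.
Proof.
move=> x Lx; rewrite (coords_eq x).
elim/big_rec: _ => [|i y _ Oy]; first exact: integers0.
apply: integersD => //; have /intrP[z ->] := Lx i.
rewrite -mulr_algl -in_algE rmorph_int; apply: integersM.
  exact: integers_int.
exact: integers_primitiveX.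
Qed.

(** The trace is a sum of conjugates of x, hence an algebraic integer, and it is rational. *)
Lemma trace_integers x : O x -> \tr (mulmat x) \is a Num.int.
Proof.
move=> [p monp rp].
suff : ratr (\tr (mulmat x)) \is a @Num.int algC.
  move=> /intrP[z]; rewrite -(ratr_int algC) => /fmorph_inj ->; exact: intr_int.
apply: Cint_rat_Aint; first exact: Crat_rat.
rewrite trace_embedding rpred_sum // => j _.
apply: (@root_monic_Aint (map_poly intr p)).
- rewrite (_ : map_poly intr p = map_poly (embedding algC j) (map_poly intr p)).
    by rewrite fmorph_root.
  by rewrite -map_poly_comp; apply: eq_map_poly => z /=; rewrite rmorph_int.
- exact: monic_map.
- by apply/polyOverP => i; rewrite coef_map; exact: intr_int.
Qed.

Definition trace_form : 'M[rat]_n :=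
  \matrix_(i, k) \tr (mulmat (theta ^+ i * theta ^+ k)).

Lemma trace_form_vandermonde : map_mx ratr trace_form =
  vandermonde F algC *m (vandermonde F algC)^T.
Proof.
apply/matrixP => i k; rewrite !mxE trace_embedding; apply: eq_bigr => j _.
by rewrite rmorphM !rmorphXn /= embedding_primitive !mxE.
Qed.

Lemma det_trace_form_neq0 : \det trace_form != 0.
Proof.
rewrite -(fmorph_eq0 (ratr : rat -> algC)) -det_map_mx trace_form_vandermonde.
by rewrite det_mulmx det_tr mulf_neq0 // det_vandermonde_neq0.
Qed.

Lemma coords_trace_form x :
  coords x *m trace_form = \row_k \tr (mulmat (x * theta ^+ k)).
Proof.
apply: (@map_mx_inj rat algC (ratr : {rmorphism rat -> algC})).
rewrite map_mxM trace_form_vandermonde mulmxA coords_embedding.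
apply/rowP => k; rewrite !mxE /= trace_embedding; apply: eq_bigr => j _.
by rewrite !mxE rmorphM rmorphXn /= embedding_primitive.
Qed.

(** The traces of the x theta^k are integers and equal [coords x] times the trace form. By Cramer's
    rule the determinant of that form, the discriminant of Z[theta], is a common denominator. *)
Lemma coords_integers : exists2 d : nat, (0 < d)%N &
  forall x, O x -> forall i, d%:R * coords x 0 i \is a Num.int.
Proof.
have [T TE] : exists T : 'M[int]_n, trace_form = map_mx intr T.
  apply: int_mxP => i k; rewrite mxE.
  by apply/trace_integers/integersM; exact: integers_primitiveX.
have detT : \det trace_form = (\det T)%:~R by rewrite TE det_map_mx.
exists `|\det T|%N.
  by rewrite absz_gt0 -(intr_eq0 rat) -detT det_trace_form_neq0.
move=> x Ox i.
have [t tE] : exists t : 'rV[int]_n, coords x *m trace_form = map_mx intr t.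
  apply: int_mxP => i0 k; rewrite coords_trace_form mxE.
  by apply/trace_integers/integersM => //; exact: integers_primitiveX.
have := congr1 (fun A => A *m \adj trace_form) tE.
rewrite -mulmxA mul_mx_adj mul_mx_scalar {2}TE -map_mx_adj -map_mxM.
move=> /rowP/(_ i); rewrite !mxE detT => E.
rewrite natr_absz intr_norm normrEsign -mulrA E rpredM ?rpred_sign //.
exact: intr_int.
Qed.

(** Since O lies in d^-1 Z[theta], the class of x is determined by d times its coordinates, taken
    modulo d. *)
Lemma index_integers_lattice : exists m, index_le O lattice m.
Proof.
have [d d0 dP] := coords_integers.
pose q x (i : 'I_n) := Num.floor (d%:R * coords x 0 i).
pose phi x : {ffun 'I_n -> 'I_d} := [ffun i =>
  Ordinal (ltn_pmod `|(q x i %% d)%Z|%N d0)].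
exists #|{ffun 'I_n -> 'I_d}|, {ffun 'I_n -> 'I_d}, phi; split=> // x y Ox Oy e i.
have qE z : O z -> coords z 0 i = (q z i)%:~R / d%:R.
  by move=> Oz; rewrite floorK ?dP // mulrC mulKf // pnatr_eq0 -lt0n.
have := congr1 (fun f : {ffun _ -> 'I_d} => val (f i)) e.
rewrite !ffunE /= => ei.
have mlt z : (`|(q z i %% d)%Z| %% d = `|(q z i %% d)%Z|)%N.
  by rewrite modn_small // -ltz_nat gez0_abs ?modz_ge0 ?ltz_pmod // eqz_nat -lt0n.
have /eqP : (q x i = q y i %[mod d])%Z.
  have g0 z : (0 <= q z i %% d)%Z by rewrite modz_ge0 // eqz_nat -lt0n.
  by rewrite -[LHS]gez0_abs // -[RHS]gez0_abs // -(mlt x) -(mlt y) ei.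
rewrite eqz_mod_dvd => /dvdzP[z zE].
rewrite coordsB !qE // -mulrBl -rmorphB /= zE rmorphM /=.
by rewrite mulfK ?intr_int // pnatr_eq0 -lt0n.
Qed.

Lemma norm_neq0 x : x != 0 -> norm x != 0.
Proof.
move=> x0; rewrite -(fmorph_eq0 (ratr : rat -> algC)) /= norm_embedding.
by apply/prodf_neq0 => j _; rewrite fmorph_eq0.
Qed.

(** The rows of the integer matrix of g span the coordinates of g Z[theta], so [int_row_index]
    applies. *)
Lemma index_lattice_scale g : g != 0 -> (forall i j, mulmat g i j \is a Num.int) ->
  exists2 N : nat, `|norm g| = N%:R & index_le lattice (scale_set g lattice) N.
Proof.
move=> g0 /int_mxP[A AE].
have nE : norm g = (\det A)%:~R by rewrite /norm AE det_map_mx.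
exists `|\det A|%N; first by rewrite nE natr_absz intr_norm.
have A0 : \det A != 0 by rewrite -(intr_eq0 rat) -nE norm_neq0.
have [T [phi [cT phiP]]] := int_row_index A0.
exists T, (fun x => phi (map_mx Num.floor (coords x))); split=> // x y Lx Ly.
move=> /phiP[w wE].
have cE z : lattice z -> coords z = map_mx intr (map_mx Num.floor (coords z)).
  by move=> Lz; apply/rowP => i; rewrite !mxE floorK //; have := Lz i; rewrite mxE.
have cw := coords_sum (map_mx intr w).
exists (\sum_i (map_mx intr w : 'rV[rat]_n) 0 i *: theta ^+ i).
  by move=> i; rewrite cw mxE; exact: intr_int.
apply: coords_inj.
by rewrite coordsM cw AE -map_mxM -wE map_mxB -!cE // linearB.
Qed.

(** The m^n elements with all coordinates in [0, m) are pairwise incongruent modulo m. *)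
Lemma index_ge_lattice_nat (m : nat) : (0 < m)%N ->
  index_ge lattice (scale_set m%:R lattice) (m ^ n).
Proof.
move=> m0; pose c (t : {ffun 'I_n -> 'I_m}) : 'rV[rat]_n := \row_i (t i : nat)%:R.
exists {ffun 'I_n -> 'I_m}, (fun t => \sum_i c t 0 i *: theta ^+ i); split.
- by rewrite card_ffun !card_ord.
- by move=> t i; rewrite coords_sum mxE rpred_nat.
move=> t u [y Ly yE]; apply/ffunP => i.
have := congr1 (fun x => coords x 0 i) yE.
rewrite coordsB !coords_sum mulr_natl -scaler_nat linearZ.
rewrite [LHS]mxE [X in _ = X - _]mxE [X in _ = _ - X]mxE.
have /intrP[z ->] := Ly i; move=> e.
have {}e : (m%:Z * z = (t i)%:Z - (u i)%:Z)%R.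
  by apply: (@intr_inj rat); rewrite rmorphM rmorphB.
apply: val_inj => /=.
have : ((t i)%:Z == (u i)%:Z %[mod m])%Z by rewrite eqz_mod_dvd -e dvdz_mulr.
by rewrite !modz_small ?ltz_nat ?ltn_ord // => /eqP[].
Qed.

Lemma scaled_mulmat_int (a : F) : a != 0 -> exists m : nat, [/\ (0 < m)%N,
  O (m%:R * a) & forall i j, mulmat (m%:R * a) i j \is a Num.int].
Proof.
move=> a0.
have [m m0 mP] := common_denominator (fun p : 'I_n * 'I_n => mulmat a p.1 p.2).
have [d d0 Od] := integral_multiple a.
exists (d * m)%N; rewrite muln_gt0 d0 m0; split => //.
  by rewrite mulnC natrM -mulrA; apply: integersM => //; exact: integers_nat.
move=> i j; rewrite natrM -mulrA mulr_natl -scaler_nat mulmatZ mulr_natl.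
rewrite -scaler_nat mulmatZ mxE [X in _ * X]mxE rpredM ?rpred_nat //.
exact: (mP (i, j)).
Qed.

(** The chain runs from O to Z[theta] and on to ma Z[theta], which is contained in aO. *)
Lemma integers_index a : a != 0 -> exists m, index_le O (scale_set a O) m.
Proof.
move=> a0; have [m [m0 _ mP]] := scaled_mulmat_int a0.
have g0 : m%:R * a != 0.
  rewrite mulf_neq0 // -(rmorph_nat (in_alg F)) fmorph_eq0 pnatr_eq0 -lt0n //.
have [N _ LN] := index_lattice_scale g0 mP.
have [c Oc] := index_integers_lattice.
exists (c * N)%N; apply: index_le_trans Oc _; apply: index_leS LN => //.
move=> _ [y Ly <-]; exists (m%:R * y); last by rewrite mulrCA mulrA.
apply: integersM; [exact: integers_nat|exact: lattice_integers].
Qed.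

End Lattice.

(** * Ideals of the ring of integers *)

Section Ideals.
Local Open Scope classical_set_scope.
Variable F : fieldExtType rat.
Implicit Types (A B C P Q : set F) (x y a : F).
Notation O := (integers F).

Definition omodule A := subgroup A /\ forall a x, O a -> A x -> A (a * x).

Lemma omodule_integers : omodule O.
Proof. by split; [exact: subgroup_integers|exact: integersM]. Qed.

Lemma omodule_ideal P : is_ideal P -> omodule P.
Proof.
move=> [PO P0 PD PM]; split => //; split => // x y Px Py.
apply: PD => //; rewrite -mulN1r; apply: PM => //.
exact: (subgroupN subgroup_integers integers1).
Qed.

Lemma omodule_scale g A : omodule A -> omodule (scale_set g A).
Proof.
move=> [sgA AM]; split; first exact: subgroup_scale.
by move=> a _ Oa [x Ax <-]; exists (a * x); [exact: AM|exact: mulrCA].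
Qed.

Lemma mul_ideal_mem A B x y : A x -> B y -> mul_ideal A B (x * y).
Proof.
move=> Ax By; exists [:: (x, y)]; last by rewrite big_seq1.
by move=> p; rewrite inE => /eqP ->.
Qed.

Lemma mul_ideal_sub A B C : subgroup C ->
  (forall x y, A x -> B y -> C (x * y)) -> mul_ideal A B `<=` C.
Proof.
move=> sgC AB _ [s sAB ->]; rewrite big_seq; apply: subgroup_sum => // p ps.
by apply: AB; have [] := sAB p ps.
Qed.

Lemma omodule_mul A B : omodule B -> omodule (mul_ideal A B).
Proof.
move=> [sgB BM]; split; last first.
  move=> a _ Oa [s sAB ->]; exists [seq (r.1, a * r.2) | r <- s].
    by move=> _ /mapP[p ps ->] /=; have [Ap Bp] := sAB p ps; split => //; exact: BM.
  by rewrite big_map mulr_sumr; apply: eq_bigr => p _; rewrite mulrCA.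
split; first by exists [::]; rewrite ?big_nil.
move=> _ _ [s sAB ->] [t tAB ->]; exists (s ++ [seq (r.1, - r.2) | r <- t]).
  move=> p; rewrite mem_cat => /orP[/sAB//|/mapP[r rt ->] /=].
  by have [Ar Br] := tAB r rt; split => //; exact: subgroupN.
rewrite big_cat big_map -sumrN /=; congr (_ + _).
by apply: eq_bigr => p _; rewrite mulrN.
Qed.

Lemma mul_ideal_subr A B : A `<=` O -> omodule B -> mul_ideal A B `<=` B.
Proof.
by move=> AO [sgB BM]; apply: mul_ideal_sub => // x y /AO Ox; exact: BM.
Qed.

Lemma mul_idealCA_sub A B C : omodule C ->
  mul_ideal A (mul_ideal B C) `<=` mul_ideal B (mul_ideal A C).
Proof.
move=> omC; apply: mul_ideal_sub.
  by have [] := omodule_mul B (omodule_mul A omC).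
move=> x _ Ax [s sBC ->]; rewrite mulr_sumr big_seq; apply: subgroup_sum.
  by have [] := omodule_mul B (omodule_mul A omC).
move=> p /sBC[Bp Cp]; rewrite mulrCA; do 2 apply: mul_ideal_mem => //.
Qed.

Lemma nat_collision (T : finType) (f : nat -> T) :
  exists i j, (i < j)%N /\ f i = f j.
Proof.
apply: contrapT => nex.
suff /leq_card : injective (fun i : 'I_#|T|.+1 => f i) by rewrite card_ord ltnn.
move=> i j e; apply: val_inj; case: (ltngtP i j) => // h; case: nex.
  by exists i, j.
by exists j, i.
Qed.

Lemma index_collision A B m (u : nat -> F) : index_le A B m ->
  (forall i, A (u i)) -> exists i j, (i < j)%N /\ B (u j - u i).
Proof.
move=> [T [phi [_ phiP]]] Au; have [i [j [ij e]]] := nat_collision (phi \o u).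
by exists i, j; split => //; apply: phiP.
Qed.

(* The ideals generated by q^i p for i < k all contain pO, which has finite
   index, hence two of them coincide. *)
Lemma integers_bounded_powers (p q : F) : p != 0 -> (forall k, O (q ^+ k * p)) -> O q.
Proof.
move=> p0 Oqp; have [m [T [phi [_ phiP]]]] := integers_index p0.
pose Ak k : set F := [set x | exists2 c : nat -> F, forall i, O (c i) &
  x = \sum_(i < k) c i * (q ^+ i * p)].
pose S k : {set T} :=
  finset (fun t => `[< exists2 x, Ak k.+1 x & phi x = t >]).
have [i [j [ij SE]]] := nat_collision S.
have AkO k x : Ak k x -> O x.
  move=> [c Oc ->]; apply: subgroup_sum => [|l _]; first exact: subgroup_integers.
  exact: integersM.
have : phi (q ^+ i.+1 * p) \in S j.
  rewrite inE; apply/asboolP; exists (q ^+ i.+1 * p) => //.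
  exists (fun l => (l == i.+1)%:R); first by move=> l; exact: integral_nat.
  have i1j : (i.+1 < j.+1)%N by [].
  rewrite (bigD1 (Ordinal i1j)) //= eqxx mul1r big1 ?addr0 // => l.
  by rewrite -val_eqE /= => /negbTE ->; rewrite mul0r.
rewrite -SE inE => /asboolP[x Ax /esym e].
have [z Oz zE] := phiP _ _ (Oqp i.+1) (AkO _ _ Ax) e.
have [c Oc xE] := Ax.
(* Now q^(i+1) p is a combination of the q^l p with l <= i, plus pz. The term pz is absorbed into
   the constant coefficient, and dividing by p leaves a monic equation for q. *)
pose d l : F := c l + (if l == 0%N then z else 0).
pose P : {poly F} := 'X^(i.+1) - \poly_(l < i.+1) d l.
have sP : (size (\poly_(l < i.+1) d l) < size ('X^(i.+1) : {poly F}))%N.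
  by rewrite size_polyXn ltnS size_poly.
apply: (@integral_root_monic _ _ (intr : int -> F) q P).
- by rewrite monicE lead_coefDl ?size_polyN // lead_coefXn.
- rewrite rootE /P !hornerE horner_poly subr_eq0; apply/eqP.
  apply: (mulIf p0); rewrite mulr_suml -[LHS](subrK x) -zE xE.
  under [RHS]eq_bigr => l _ do rewrite /d -mulrA mulrDl.
  rewrite big_split /= addrC; congr (_ + _).
  rewrite big_ord_recl /= expr0 mul1r [p * z]mulrC big1 ?addr0 // => l _.
  by rewrite mul0r.
- have Od l : O (d l).
    apply: subgroupD => //; first exact: subgroup_integers.
    by case: ifP => // _; exact: integers0.
  move=> _ /(nthP 0)[l lP <-]; rewrite coefB coefXn coef_poly.
  apply: integersB; first exact: integral_nat.
  by case: ifP => _; [exact: Od|exact: integers0].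
Qed.

Lemma prime_nonzero P : prime_ideals F P -> exists2 a, P a & a != 0.
Proof.
move=> [[[_ P0 _ _] _ _] Pn0]; apply: contrapT => nex; apply: Pn0.
apply/seteqP; split => [x Px|_ -> //] /=.
by apply: contrapT => /eqP x0; apply: nex; exists x.
Qed.

Lemma prime_integers P : prime_ideals F P -> P `<=` O.
Proof. by move=> [[[]]]. Qed.

Lemma prime_omodule P : prime_ideals F P -> omodule P.
Proof. by move=> [[/omodule_ideal]]. Qed.

Lemma prime_index P : prime_ideals F P -> exists m, index_le O P m.
Proof.
move=> pP; have [a Pa a0] := prime_nonzero pP.
have [m Om] := integers_index a0; exists m.
apply: index_leS Om => // _ [x Ox <-].
by rewrite mulrC; apply: (prime_omodule pP).2.
Qed.

Lemma prime_pow P x k : prime_ideals F P -> O x -> P (x ^+ k) -> P x.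
Proof.
move=> [[_ P1 PM] _] Ox; elim: k => [//|k IH].
by rewrite exprS => /PM[//||//|]; [exact: integersX|exact: IH].
Qed.

(* A finite integral domain is a field. *)
Lemma prime_maximal P s : prime_ideals F P -> O s -> ~ P s ->
  exists2 v, O v & P (s * v - 1).
Proof.
move=> pP Os Ps; have [m Om] := prime_index pP.
have [i [j [ij]]] := index_collision Om (fun i => integersX i Os).
(* Two powers of s agree modulo P; primality cancels s^i, so s^(j-i-1) inverts s. *)
have -> : s ^+ j - s ^+ i = s ^+ i * (s * s ^+ (j - i).-1 - 1).
  by rewrite mulrBr mulr1 mulrA -exprSr -exprD addSnnS prednK ?subnKC ?subn_gt0 // ltnW.
case: (pP) => [[_ P1 PM] _] /PM[||/(prime_pow pP Os)//|Psv].
- exact: integersX.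
- apply: integersB; last exact: integers1.
  by apply: integersM => //; exact: integersX.
- by exists (s ^+ (j - i).-1) => //; exact: integersX.
Qed.

(* A maximal ideal of the finite ring O/aO is the annihilator of some y. *)
Lemma prime_annihilator P a : prime_ideals F P -> P a -> a != 0 ->
  exists y, [/\ O y, ~ scale_set a O y & forall x, P x -> scale_set a O (x * y)].
Proof.
move=> pP Pa a0; have [m Om] := integers_index a0.
have [T [phi [_ phiP]]] := Om.
have omI : omodule (scale_set a O) by apply/omodule_scale/omodule_integers.
have [[PI P1 PM] _] := pP; have PO := prime_integers pP.
pose Ann y : set F := [set x | O x /\ scale_set a O (x * y)].
pose S y : {set T} := finset (fun t => `[< exists2 x, Ann y x & phi x = t >]).
(* Annihilators contained in P are compared by their number of labels modulo aO, and y is chosen to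
   maximise it. *)
pose G c := `[< exists y, [/\ O y, Ann y `<=` P & #|S y| = c] >].
have exG : exists c, G c.
  exists #|S 1|; apply/asboolP; exists 1; split => //; first exact: integers1.
  move=> x [Ox]; rewrite mulr1 => -[z Oz <-].
  by rewrite mulrC; apply: (prime_omodule pP).2.
have ubG c : G c -> (c <= #|T|)%N.
  by move=> /asboolP[y [_ _ <-]]; exact: max_card.
have [c /asboolP[y [Oy AyP yc]] maxc] := ex_maxnP exG ubG.
have maxy y' : O y' -> Ann y `<=` Ann y' -> Ann y' `<=` P -> Ann y' `<=` Ann y.
  move=> Oy' yy' y'P.
  have sS : S y \subset S y'.
    apply/fintype.subsetP => t; rewrite !inE => /asboolP[x /yy' Ax xt].
    by apply/asboolP; exists x.
  have /eqP SE : S y == S y'.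
    by rewrite eqEcard sS yc; apply: maxc; apply/asboolP; exists y'.
  move=> x' Ax'; have : phi x' \in S y'.
    by rewrite inE; apply/asboolP; exists x'.
  rewrite -SE inE => /asboolP[x [Ox xy] e]; have Ox' := Ax'.1; split => //.
  rewrite -[x'](subrK x) mulrDl; apply: subgroupD => //; first exact: omI.1.
  rewrite mulrC; apply: omI.2 => //; exact: phiP.
have annM z x : O z -> Ann y x -> Ann (z * y) x.
  by move=> Oz [Ox xy]; split => //; rewrite mulrCA; exact: omI.2.
exists y; split => //.
  by move=> ay; apply/P1/AyP; split; [exact: integers1|rewrite mul1r].
move=> p Pp; apply: contrapT => npy.
have Op := PO _ Pp.
(* If some s outside P kills py, then Ann(sy) lies in P by primality, and maximality puts p into
   Ann(y). *)
have [[s [Os Ps spy]]|nex] :=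
    pselect (exists s, [/\ O s, ~ P s & scale_set a O (s * (p * y))]).
  apply: npy; suff [] : Ann y p by [].
  apply: (maxy (s * y)) => //; first exact: integersM.
  - by move=> x; exact: annM.
  - move=> x [Ox xsy]; have /AyP/PM[] // : Ann y (x * s).
      by split; [exact: integersM|rewrite -mulrA].
  - by split => //; rewrite mulrCA.
(* Otherwise Ann(py) lies in P, so by maximality factors p can be cancelled inside Ann(y). A
   collision of powers of p then puts some p^k - 1 with k > 0 into P, hence also 1. *)
have AE : Ann (p * y) `<=` Ann y.
  apply: maxy; [exact: integersM|by move=> x; exact: annM|].
  by move=> x [Ox xpy]; apply: contrapT => Px; apply: nex; exists x.
have AX k x : Ann y (p ^+ k * x) -> O x -> Ann y x.
  elim: k => [|k IH] in x *; first by rewrite expr0 mul1r.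
  rewrite exprSr -mulrA => Ax Ox; have /AE// : Ann (p * y) x.
  have [_] := IH _ Ax (integersM Op Ox).
  by split => //; rewrite mulrA [x * p]mulrC.
have [i [j [ij]]] := index_collision Om (fun i => integersX i Op).
have -> : p ^+ j - p ^+ i = p ^+ i * (p ^+ (j - i) - 1).
  by rewrite mulrBr mulr1 -exprD subnKC // ltnW.
have Oq : O (p ^+ (j - i) - 1).
  by apply: integersB; [exact: integersX|exact: integers1].
move=> aq; have /AX/(_ Oq)/AyP Pq : Ann y (p ^+ i * (p ^+ (j - i) - 1)).
  split; first by apply: integersM => //; exact: integersX.
  by rewrite mulrC; apply: omI.2.
apply: P1; have sgP := (prime_omodule pP).1.
rewrite -[1](subKr (p ^+ (j - i))); apply: sgP.2 => //.
rewrite -(subnSK ij) exprSr; apply: (prime_omodule pP).2 => //.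
exact: integersX.
Qed.

(** With y from [prime_annihilator], y/a maps P into O but is not in O. If it mapped P into P, its
    powers times a would all be integers and it would be integral. So it sends some p outside P, and
    an inverse v modulo P of that image corrects y/a to v y/a. *)
Lemma prime_inverse P : prime_ideals F P -> exists p q,
  [/\ P p, forall x, P x -> O (q * x) & P (p * q - 1)].
Proof.
move=> pP; have [a Pa a0] := prime_nonzero pP.
have [y [Oy ay Py]] := prime_annihilator pP Pa a0.
have PO := prime_integers pP.
pose q := a^-1 * y.
have Oq x : P x -> O (q * x).
  move=> /Py/scale_setP -/(_ a0).
  by rewrite [x * y]mulrC mulrA.
have [qP|] := pselect (forall x, P x -> P (q * x)).
  case: ay; apply/scale_setP => //; apply: (integers_bounded_powers a0) => k.
  apply: PO; elim: k => [|k IH]; first by rewrite expr0 mul1r.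
  by rewrite exprS -mulrA; exact: qP.
move=> /existsNP[p /not_implyP[Pp nP]].
have [v Ov Pv] := prime_maximal pP (Oq _ Pp) nP.
exists p, (q * v); split => // [x Px|]; last by rewrite mulrA [p * q]mulrC.
by rewrite mulrAC; apply: integersM => //; exact: Oq.
Qed.

Lemma prime_sub_eq P Q : prime_ideals F P -> prime_ideals F Q -> Q `<=` P -> Q = P.
Proof.
move=> pP pQ QP; apply/seteqP; split => // x Px; apply: contrapT => Qx.
have [v Ov Qv] := prime_maximal pQ (prime_integers pP Px) Qx.
have [[_ P1 _] _] := pP; apply: P1; have [sgP PM] := prime_omodule pP.
rewrite -[1](subKr (x * v)); apply: sgP.2; last exact: QP.
by rewrite mulrC; exact: PM.
Qed.

(* The two cases Q = P and Q <> P of the cancellation and index lemmas below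
   are treated together: multiplication by s maps A into QA, multiplication by v
   maps QA into A, and they are inverse to each other modulo P. *)
Lemma prime_mod_inverse P Q A : prime_ideals F P -> prime_ideals F Q ->
  omodule A -> exists s v, [/\ Q s, P (s * v - 1),
    forall x, mul_ideal Q A x -> A (v * x) &
    forall x, mul_ideal P (mul_ideal Q A) x -> mul_ideal P A (v * x)].
Proof.
move=> pP pQ omA.
suff [s [v [Qs Psv vQ]]] : exists s v,
    [/\ Q s, P (s * v - 1) & forall x, Q x -> O (v * x)].
  have vQA x : mul_ideal Q A x -> A (v * x).
    move=> [t tQA ->]; rewrite mulr_sumr big_seq; apply: subgroup_sum.
      exact: omA.1.
    by move=> p /tQA[Qp Ap]; rewrite mulrA; apply: omA.2 => //; exact: vQ.
  exists s, v; split => // x [t tPQA ->]; rewrite mulr_sumr big_seq.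
  apply: subgroup_sum; first exact: (omodule_mul P omA).1.
  move=> p /tPQA[Pp Ap]; rewrite mulrCA; apply: mul_ideal_mem => //; exact: vQA.
have [QP|] := pselect (Q `<=` P).
  have -> := prime_sub_eq pP pQ QP.
  by have [p [q [Pp qP Ppq]]] := prime_inverse pP; exists p, q.
move=> /existsNP[s /not_implyP[Qs Ps]].
have [v Ov Psv] := prime_maximal pP (prime_integers pQ Qs) Ps.
exists s, v; split => // x /(prime_integers pQ); exact: integersM.
Qed.

Lemma mul_prime_cancel P Q A : prime_ideals F P -> prime_ideals F Q ->
  omodule A -> mul_ideal Q A `<=` mul_ideal P (mul_ideal Q A) ->
  A `<=` mul_ideal P A.
Proof.
move=> pP pQ omA QPQ x Ax.
have [s [v [Qs Psv vQA vPQA]]] := prime_mod_inverse pP pQ omA.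
have -> : x = v * (s * x) - (s * v - 1) * x.
  by rewrite mulrBl mul1r [s * v]mulrC mulrA opprB addrC subrK.
apply: (omodule_mul P omA).1.2; last exact: mul_ideal_mem.
by apply/vPQA/QPQ/mul_ideal_mem.
Qed.

Lemma index_le_mul_prime P Q A m : prime_ideals F P -> prime_ideals F Q ->
  omodule A -> index_le A (mul_ideal P A) m ->
  index_le (mul_ideal Q A) (mul_ideal P (mul_ideal Q A)) m.
Proof.
move=> pP pQ omA [T [phi [mT phiP]]].
have [s [v [Qs Psv vQA vPQA]]] := prime_mod_inverse pP pQ omA.
exists T, (fun x => phi (v * x)); split => // x y Ax Ay /phiP Pxy.
have omPQA := omodule_mul P (omodule_mul Q omA).
have Axy := (omodule_mul Q omA).1.2 _ _ Ax Ay.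
have -> : x - y = s * (v * (x - y)) - (s * v - 1) * (x - y).
  by rewrite mulrBl mul1r mulrA opprB [RHS]addrC subrK.
apply: omPQA.1.2; last exact: mul_ideal_mem.
rewrite mulrBr; apply: mul_idealCA_sub => //; apply: mul_ideal_mem => //.
by apply: Pxy; exact: vQA.
Qed.

Definition prod_ideal (s : seq (set F)) : set F := foldr (@mul_ideal F) O s.

Lemma omodule_prod s : omodule (prod_ideal s).
Proof. by elim: s => [|P s IH]; [exact: omodule_integers|exact: omodule_mul]. Qed.

Lemma prod_ideal_integers s :
  (forall Q, Q \in s -> prime_ideals F Q) -> prod_ideal s `<=` O.
Proof.
elim: s => [|Q s IH] ps; first by move=> x.
have QO := prime_integers (ps Q (mem_head _ _)).
apply: subset_trans (mul_ideal_subr QO (omodule_prod s)) (IH _).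
by move=> R Rs; apply: ps; rewrite inE Rs orbT.
Qed.

Lemma mul_ideal1_sub A : omodule A -> mul_ideal A O `<=` A.
Proof.
move=> [sgA AM]; apply: mul_ideal_sub => // x y Ax Oy.
by rewrite mulrC; exact: AM.
Qed.

(** Cancelling the factors Q one by one reduces the claim to PO, which does not contain 1. *)
Lemma prime_prod_proper P s : prime_ideals F P ->
  (forall Q, Q \in s -> prime_ideals F Q) ->
  ~ (prod_ideal s `<=` mul_ideal P (prod_ideal s)).
Proof.
move=> pP; elim: s => [|Q s IH] ps.
  move=> /(_ 1 integers1)/(mul_ideal1_sub (prime_omodule pP)).
  by have [[]] := pP.
move=> /(mul_prime_cancel pP (ps Q (mem_head _ _)) (omodule_prod s)).
by apply: IH => R Rs; apply: ps; rewrite inE Rs orbT.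
Qed.

Lemma residue_class_eq P x y : subgroup P -> P (x - y) ->
  [set x + z | z in P] = [set y + z | z in P].
Proof.
move=> sgP Pxy; apply/seteqP; split => _ [z Pz <-].
  by exists (x - y + z); [exact: subgroupD|rewrite addrA addrCA subrr addr0].
exists (z - (x - y)); first exact: sgP.2.
by rewrite opprB addrCA [x + _]addrCA subrr addr0 addrC.
Qed.

(** Finite index makes [residue_classes] finite, so that [fset_set] is the actual set of classes and
    not its default value. *)
Lemma ideal_norm_index P m : subgroup P -> index_le O P m ->
  index_le O P (ideal_norm P) /\ index_ge O P (ideal_norm P).
Proof.
move=> sgP [T [phi [_ phiP]]].
pose cl x : set F := [set x + y | y in P].
have fin : finite_set (residue_classes P).
  pose rep t : set F := if pselect (exists2 x, O x & phi x = t) is left h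
    then cl (s2val (cid2 h)) else set0.
  apply: (@sub_finite_set _ _ (rep @` setT)); last exact/finite_image/finite_finset.
  move=> _ [x Ox <-]; exists (phi x) => //; rewrite /rep.
  case: pselect => [h|]; last by case; exists x.
  case: (cid2 h) => y Oy e /=; apply: residue_class_eq => //; exact: phiP.
have Pcl x y : cl x = cl y -> P (x - y).
  move=> e; have : cl x x by exists 0; rewrite ?addr0 //; exact: sgP.1.
  by rewrite e => -[z Pz <-]; rewrite addrAC subrr add0r.
pose U := fset_set (residue_classes P).
have clU x : O x -> cl x \in U 
  by move=> Ox; rewrite in_fset_set //; apply/mem_set; exists x.
have cardU : #|{: U}| = ideal_norm P by rewrite -cardfE.
split.
  exists {: U}, (fun x => insubd [` clU _ integers0]%fset (cl x)).
  split=> [|x y Ox Oy /(congr1 val)]; first by rewrite cardU.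
  by rewrite !val_insubd !clU //; exact: Pcl.
have repU (t : U) : exists2 x, O x & cl x = val t.
  by have := valP t; rewrite in_fset_set // => /set_mem.
exists {: U}, (fun t => s2val (cid2 (repU t))); split => [|t|t u].
- by rewrite cardU.
- by case: (cid2 _).
case: (cid2 (repU t)) => x Ox /= xt; case: (cid2 (repU u)) => y Oy /= yu Pxy.
by apply: val_inj; rewrite /= -xt -yu; exact: residue_class_eq.
Qed.

(** The factor P contributes [A : PA], with A the product of the remaining primes. The inner
    induction carries the bound N(P) from [O : P] to A, one prime at a time. *)
Lemma index_le_prod s : (forall Q, Q \in s -> prime_ideals F Q) ->
  index_le O (prod_ideal s) (\prod_(P <- s) ideal_norm P)%N.
Proof.
elim: s => [|P s IH] ps.
  rewrite big_nil; exists unit, (fun=> tt); rewrite card_unit; split => // x y Ox Oy _.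
  exact: integersB.
have ps' Q : Q \in s -> prime_ideals F Q by move=> Qs; apply: ps; rewrite inE Qs orbT.
have pP := ps P (mem_head _ _).
rewrite big_cons mulnC; apply: index_le_trans (IH ps') _.
have [m /(ideal_norm_index (prime_omodule pP).1)[PN _]] := prime_index pP.
elim: s ps' {IH ps} => [|Q s IH] ps /=.
  apply: index_leS PN => // x Px; rewrite -[x]mulr1; apply: mul_ideal_mem => //.
  exact: integers1.
apply: index_le_mul_prime => //; [exact/ps/mem_head|exact: omodule_prod|].
by apply: IH => R Rs; apply: ps; rewrite inE Rs orbT.
Qed.

(** For a in A outside PA, multiplication by a embeds O / P into A / PA: if ra lies in PA with r
    outside P, an inverse of r modulo P puts a into PA. *)
Lemma index_ge_prod s : (forall Q, Q \in s -> prime_ideals F Q) ->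
  index_ge O (prod_ideal s) (\prod_(P <- s) ideal_norm P)%N.
Proof.
elim: s => [|P s IH] ps.
  rewrite big_nil; exists unit, (fun=> 0); rewrite card_unit; split => //.
    by move=> _; exact: integers0.
  by case=> -[].
have ps' Q : Q \in s -> prime_ideals F Q by move=> Qs; apply: ps; rewrite inE Qs orbT.
have pP := ps P (mem_head _ _); have PO := prime_integers pP.
have [sgA AM] := omodule_prod s; have [sgPA PAM] := omodule_prod (P :: s).
rewrite big_cons mulnC.
apply: index_ge_trans (IH ps') _ => //.
- exact: subgroup_integers.
- exact: prod_ideal_integers.
- by apply: mul_ideal_subr PO _; exact: omodule_prod.
have [m /(ideal_norm_index (prime_omodule pP).1)[_]] := prime_index pP.
move=> [T [r [mT rO rinj]]].
have /existsNP[a /not_implyP[Aa Paa]] := prime_prod_proper pP ps'.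
exists T, (fun t => r t * a); split => // [t|t u].
  exact: AM.
rewrite -mulrBl => Ptu; apply: rinj; apply: contrapT => Prtu.
have Ortu : O (r t - r u) by apply: subgroup_integers.2.
have [v Ov Pv] := prime_maximal pP Ortu Prtu.
case: Paa.
have aE w : a = v * (w * a) - (w * v - 1) * a.
  by rewrite mulrBl mul1r mulrA [v * w]mulrC opprB [RHS]addrC subrK.
rewrite (aE (r t - r u)).
by apply: sgPA.2; [exact: PAM|exact: mul_ideal_mem].
Qed.

End Ideals.

(** * The norm of an element of a fractional ideal *)

Section NormBound.
Local Open Scope classical_set_scope.
Variable F : fieldExtType rat.
Implicit Types (x f g : F) (s : seq (set F)).
Notation O := (integers F).
Notation n := (\dim {:F}).
Notation L := (@lattice F).

Lemma natr_neq0 (m : nat) : (0 < m)%N -> m%:R != 0 :> F.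
Proof. by rewrite -(rmorph_nat (in_alg F)) fmorph_eq0 pnatr_eq0 lt0n. Qed.

Lemma scale_integers_sub g : O g -> scale_set g O `<=` O.
Proof. by move=> Og _ [x Ox <-]; exact: integersM. Qed.

Lemma scale_lattice_nat (m : nat) : scale_set m%:R L `<=` L.
Proof.
move=> _ [x Lx <-] i; rewrite mulr_natl -scaler_nat linearZ mxE.
by rewrite rpredM ?rpred_nat ?Lx.
Qed.

Lemma index_integers_exact : exists c : nat,
  [/\ (0 < c)%N, index_le O L c & index_ge O L c].
Proof.
have [m Om] := index_integers_lattice F.
have [c [lec gec]] := index_exact integers0 (subgroup_lattice F) Om.
exists c; split => //; apply: index_ge_le lec.
exists unit, (fun=> 0); rewrite card_unit; split => // [_|[] []//].
exact: integers0.
Qed.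

Lemma index_integers_scale_exact g : O g -> g != 0 ->
  exists e, index_le O (scale_set g O) e /\ index_ge O (scale_set g O) e.
Proof.
move=> Og g0; have [m Om] := integers_index g0.
apply: index_exact Om; first exact: integers0.
exact/subgroup_scale/subgroup_integers.
Qed.

(* [O : gO] = [L : gL], since [O : L] = [gO : gL]. *)
Lemma index_integers_scale_le g N : O g -> g != 0 ->
  index_le L (scale_set g L) N -> index_le O (scale_set g O) N.
Proof.
move=> Og g0 LN; have [c [c0 lec gec]] := index_integers_exact.
have [e [lee gee]] := index_integers_scale_exact Og g0.
(* Here e = [O : gO] and c = [O : L]. The chains from O to gL through gO and through L are compared,
   and c cancels. *)
suff : (e * c <= c * N)%N.
  rewrite mulnC leq_pmul2l // => eN; case: lee => T [phi [cT phiP]].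
  by exists T, phi; split => //; exact: leq_trans eN.
have sgO : subgroup (scale_set g O) := subgroup_scale g subgroup_integers.
apply: index_ge_le (index_le_trans lec LN).
apply: index_ge_trans sgO _ _ gee (index_ge_scale g0 gec).
- exact: subgroup_integers.
- exact: scale_integers_sub.
- exact/scale_setS/lattice_integers.
Qed.

(** The two chains from O to gL again, compared in the opposite direction. *)
Lemma index_integers_scale_ge g N : O g -> g != 0 -> scale_set g L `<=` L ->
  index_ge L (scale_set g L) N -> index_ge O (scale_set g O) N.
Proof.
move=> Og g0 gL LN; have [c [c0 lec gec]] := index_integers_exact.
have [e [lee gee]] := index_integers_scale_exact Og g0.
suff : (c * N <= e * c)%N.
  rewrite mulnC leq_pmul2r // => Ne; case: gee => T [s [cT sO sinj]].
  by exists T, s; split => //; exact: leq_trans cT.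
apply: index_ge_le (index_le_trans lee (index_le_scale g0 lec)).
apply: index_ge_trans (subgroup_lattice F) (@lattice_integers F) gL gec LN.
exact: subgroup_integers.
Qed.

(** Let A and B be the products over [s1] and [s2], and let g = mf be integral. As gA lies in mB,
    [O : mB] >= m^n N(B) is compared with [O : gA] <= |N(g)| N(A), where |N(g)| = m^n |N(f)|. *)
Lemma norm_ge_prod f s1 s2 : f != 0 ->
  (forall Q, Q \in s1 -> prime_ideals F Q) ->
  (forall Q, Q \in s2 -> prime_ideals F Q) ->
  (forall x, prod_ideal s1 x -> prod_ideal s2 (f * x)) ->
  (\prod_(P <- s2) ideal_norm P)%N%:R <=
    `|norm f| * (\prod_(P <- s1) ideal_norm P)%N%:R.
Proof.
move=> f0 ps1 ps2 fs12.
have [m [m0 Og gint]] := scaled_mulmat_int f0.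
have m0F := natr_neq0 m0; set g := m%:R * f in Og gint.
have g0 : g != 0 by rewrite mulf_neq0.
have [N nE LN] := index_lattice_scale g0 gint.
have gE : N%:R = m%:R ^+ n * `|norm f|.
  rewrite -nE /norm /g mulr_natl -scaler_nat mulmatZ detZ normrM.
  by rewrite normrX ger0_norm ?ler0n.
have le1 : index_le O (scale_set g (prod_ideal s1))
    (N * \prod_(P <- s1) ideal_norm P).
  apply: index_le_trans (index_integers_scale_le Og g0 LN) _.
  exact/index_le_scale/index_le_prod.
have ge2 : index_ge O (scale_set m%:R (prod_ideal s2))
    (m ^ n * \prod_(P <- s2) ideal_norm P).
  have Om := @integers_nat F m.
  have mL := index_integers_scale_ge Om m0F (@scale_lattice_nat m)
    (index_ge_lattice_nat F m0).
  apply: index_ge_trans subgroup_integers _ _ _ mL _.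
  - exact/subgroup_scale/subgroup_integers.
  - exact: scale_integers_sub.
  - exact/scale_setS/prod_ideal_integers.
  - exact/index_ge_scale/index_ge_prod.
have : (m ^ n * \prod_(P <- s2) ideal_norm P <=
    N * \prod_(P <- s1) ideal_norm P)%N.
  apply: index_ge_le ge2 _; apply: index_leS le1 => // _ [x sx <-].
  by exists (f * x); [exact: fs12|rewrite mulrA].
rewrite -(ler_nat rat) !natrM natrX gE -mulrA ler_pM2l //.
by rewrite exprn_gt0 // ltr0n.
Qed.

End NormBound.

(** * Arakelov divisors *)

Definition posz (z : int) : nat := if z is Posz k then k else 0%N.

Section DivisorIdeal.
Local Open Scope classical_set_scope.
Variable F : fieldExtType rat.
Implicit Types (A : set F) (c : prime_ideals F -> int) (l : seq (prime_ideals F)).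
Notation O := (integers F).

Definition mul_ideals (s : seq (set F)) A := foldr (@mul_ideal F) A s.

Lemma omodule_mul_ideals s A : omodule A -> omodule (mul_ideals s A).
Proof. by move=> omA; elim: s => // P s IH; exact: omodule_mul. Qed.

Lemma iter_mul_ideal k P A f x : omodule A ->
  iter k (mul_ideal P) O f -> A x -> mul_ideals (nseq k P) A (f * x).
Proof.
move=> omA; elim: k f x => [|k IH] f x /=; first exact: omA.2.
have [sg _] := omodule_mul P (omodule_mul_ideals (nseq k P) omA).
move=> [s sP ->] Ax; rewrite mulr_suml big_seq; apply: subgroup_sum => //.
move=> [p g] /sP[Pp Ig]; rewrite -mulrA; apply: mul_ideal_mem => //; exact: IH.
Qed.

(** The k inverse factors of f are paired with the k factors P of x, and each pair multiplies into
    O. *)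
Lemma iter_inv_ideal k P A f x : omodule A ->
  iter k (mul_ideal (inv_ideal P)) O f -> mul_ideals (nseq k P) A x -> A (f * x).
Proof.
move=> omA; elim: k f x => [|k IH] f x /=; first exact: omA.2.
move=> [s sP ->] [t tP ->]; rewrite mulr_suml big_seq.
apply: subgroup_sum => [|[q g] /sP[Iq Ig]]; first exact: omA.1.
rewrite mulr_sumr big_seq; apply: subgroup_sum => [|[p y] /tP[Pp Ay]].
  exact: omA.1.
rewrite mulrACA; apply: omA.2; [exact: Iq|exact: IH].
Qed.

(** The primes of J, and in [zero_list] those of K, with multiplicity. As the ideal has exponents
    -c, a positive coefficient allows poles and a negative one forces zeros. *)
Definition pole_list c l : seq (set F) :=
  flatten [seq nseq (posz (c P)) (val P) | P <- l].

Definition zero_list c l : seq (set F) :=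
  flatten [seq nseq (posz (- c P)) (val P) | P <- l].

Lemma mem_pole_list c l Q : Q \in pole_list c l -> prime_ideals F Q.
Proof.
by move=> /flattenP[_ /mapP[P _ ->]]; rewrite mem_nseq => /andP[_ /eqP ->]; exact: set_valP.
Qed.

Lemma mem_zero_list c l Q : Q \in zero_list c l -> prime_ideals F Q.
Proof.
by move=> /flattenP[_ /mapP[P _ ->]]; rewrite mem_nseq => /andP[_ /eqP ->]; exact: set_valP.
Qed.

(** At a positive coefficient the inverse factors of f cancel the copies of P in x; at a negative
    one f supplies the copies of P that the target requires. *)
Lemma divisor_ideal_mul c l f x :
  (\big[@mul_ideal F/O]_(P <- l) pow_ideal (val P) (- c P)) f ->
  prod_ideal (pole_list c l) x -> prod_ideal (zero_list c l) (f * x).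
Proof.
elim: l f x => [|P l IH] f x; first by rewrite big_nil; exact: integersM.
rewrite big_cons /pole_list /zero_list /= /prod_ideal !foldr_cat.
rewrite -/(mul_ideals _ _) -/(prod_ideal _) -/(pole_list c l).
rewrite -/(mul_ideals _ _) -/(prod_ideal _) -/(zero_list c l).
have omz := omodule_prod (zero_list c l).
have omp := omodule_prod (pole_list c l).
move=> [s sP ->] Px; rewrite mulr_suml big_seq; apply: subgroup_sum.
  exact: (omodule_mul_ideals _ omz).1.
move=> [a b] /sP[/=]; case: (c P) Px => [[|k]|k] Px pa Ib.
- by rewrite -mulrA; apply: omz.2 => //; exact: IH.
- by rewrite mulrAC mulrC; apply: IH => //; apply: iter_inv_ideal Px.
- by rewrite -mulrA; apply: iter_mul_ideal => //; exact: IH.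
Qed.

Lemma pow_ideal_nonzero P z : prime_ideals F P ->
  exists2 f, pow_ideal P z f & f != 0.
Proof.
move=> pP; have [a Pa a0] := prime_nonzero pP.
have iter_nz A : (exists2 f, A f & f != 0) -> forall k,
    exists2 f, iter k (mul_ideal A) O f & f != 0.
  move=> [b Ab b0]; elim=> [|k [f If f0]].
    by exists 1; [exact: integers1|exact: oner_neq0].
  by exists (b * f); [exact: mul_ideal_mem|exact: mulf_neq0].
case: z => k; apply: iter_nz; first by exists a.
exists 1; last exact: oner_neq0.
by move=> x /(prime_integers pP); rewrite mul1r.
Qed.

End DivisorIdeal.

(** * The ideal of a divisor and the finite part of its degree *)

Section Divisor.
Local Open Scope classical_set_scope.
Variables (R : realType) (F : fieldExtType rat) (C : conjugate_choice R F).
Variable D : arakelov_divisor C.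
Notation O := (integers F).

Let supp := fset_set [set P | fin_coef D P != 0].

Definition fin_degree : R := \sum_(P \in [set: prime_ideals F])
  ln ((ideal_norm (val P))%:R : R) * (fin_coef D P)%:~R.

Lemma fin_degreeE : fin_degree =
  \sum_(P <- supp) ln ((ideal_norm (val P))%:R : R) * (fin_coef D P)%:~R.
Proof.
rewrite /fin_degree /supp -fsbig_finite; last exact: fin_coef_finite.
apply/esym/fsbig_widen => // P [_ /= /negP/negPn/eqP ->].
by rewrite mulr0.
Qed.

(** The colon module (K : J). It contains I and the norm bound holds on all of it, so its group
    structure serves for differences of points of I. *)
Definition colon_ideal : set F := [set f | forall x,
  prod_ideal (pole_list (fin_coef D) supp) x ->
  prod_ideal (zero_list (fin_coef D) supp) (f * x)].

Lemma divisor_colon : divisor_ideal D `<=` colon_ideal.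
Proof. move=> f If x; exact: divisor_ideal_mul. Qed.

Lemma subgroup_colon : subgroup colon_ideal.
Proof.
have [sg _] := omodule_prod (zero_list (fin_coef D) supp).
split=> [x _|f g If Ig x Px]; first by rewrite mul0r; exact: sg.1.
by rewrite mulrBl; apply: sg.2; [exact: If|exact: Ig].
Qed.

Lemma divisor_ideal0 : divisor_ideal D 0.
Proof.
rewrite /divisor_ideal; elim/big_ind: _; first exact: integers0.
  by move=> A B _ _; exists [::]; rewrite ?big_nil.
move=> P _; case: (- _) => [[|k]|k]; first exact: integers0.
- by exists [::]; rewrite ?big_nil.
- by exists [::]; rewrite ?big_nil.
Qed.

(** Supplies the positive term that makes the first inequality of the theorem strict. *)
Lemma divisor_ideal_nonzero : exists2 f, divisor_ideal D f & f != 0.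
Proof.
rewrite /divisor_ideal; elim/big_ind: _.
- by exists 1; [exact: integers1|exact: oner_neq0].
- move=> A B [f Af f0] [g Bg g0]; exists (f * g); first exact: mul_ideal_mem.
  exact: mulf_neq0.
- by move=> P _; apply: pow_ideal_nonzero; exact: set_valP.
Qed.

Lemma ideal_norm_gt0 P : prime_ideals F P -> (0 < ideal_norm P)%N.
Proof.
move=> pP; have [m] := prime_index pP.
move=> /(ideal_norm_index (prime_omodule pP).1)[PN _].
apply: index_ge_le PN; exists unit, (fun=> 0); rewrite card_unit; split => //.
  by move=> _; exact: integers0.
by case=> -[].
Qed.

(** Prime by prime, the positive part of c is its negative part plus c. *)
Lemma prod_norm_pole (l : seq (prime_ideals F)) (c : prime_ideals F -> int) :
  (\prod_(P <- pole_list c l) ideal_norm P)%N%:R =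
  (\prod_(P <- zero_list c l) ideal_norm P)%N%:R *
    expR (\sum_(P <- l) ln ((ideal_norm (val P))%:R : R) * (c P)%:~R).
Proof.
rewrite !big_flatten !big_map expR_sum !natr_prod -big_split /=.
apply: eq_bigr => P _; have N0 : 0 < (ideal_norm (val P))%:R :> R.
  by rewrite ltr0n; apply/ideal_norm_gt0/set_valP.
rewrite !big_nseq !iter_muln_1 !natrX.
have expR_ln_nat k : expR (ln (ideal_norm (val P))%:R * k%:R) =
    (ideal_norm (val P))%:R ^+ k :> R by rewrite expRM_natr lnK.
case: (c P) => [[|k]|k]; first by rewrite mulr0 expR0 mulr1.
  by rewrite expr0 mul1r expR_ln_nat.
rewrite NegzE mulrN expRN expR_ln_nat mulfV //.
by rewrite expf_neq0 // gt_eqF.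
Qed.

(** Since fJ lies in K, |N(f)| >= N(K) / N(J), and [prod_norm_pole] evaluates the quotient. *)
Lemma norm_ge_divisor f : colon_ideal f -> f != 0 ->
  expR (- fin_degree) <= ratr `|norm f| :> R.
Proof.
move=> If f0.
have := norm_ge_prod f0 (@mem_pole_list _ _ _) (@mem_zero_list _ _ _) If.
rewrite -(ler_rat R) rmorphM /= !ratr_nat (prod_norm_pole supp (fin_coef D)) -fin_degreeE.
set N := (\prod_(P <- zero_list _ _) _)%N.
have N0 : 0 < N%:R :> R.
  rewrite ltr0n /N big_seq; apply: prodn_cond_gt0 => P Ps.
  exact/ideal_norm_gt0/(mem_zero_list Ps).
rewrite mulrCA -[X in X <= _]mulr1 ler_pM2l // expRN.
by rewrite -ler_pdivrMr ?expR_gt0 // mul1r.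
Qed.

End Divisor.

(** * Infinite primes, complex conjugation and the lower bound for the norm of a divisor *)

Section InfinitePrimes.
Local Open Scope classical_set_scope.
Variables (R : realType) (F : fieldExtType rat) (C : conjugate_choice R F).
Notation n := (\dim {:F}).
Notation emb := (embedding R[i]).
Notation abs := (@Normc.normc R).
Implicit Types j : 'I_n.

Lemma embeddingsP (s : F -> R[i]) : embeddings s <-> exists j, s = emb j.
Proof.
split=> [[sD sM]|[j ->]].
  pose aD := GRing.isZmodMorphism.Build F R[i] s sD.
  pose aM := GRing.isMonoidMorphism.Build F R[i] s sM.
  pose t : {rmorphism F -> R[i]} := HB.pack s aD aM.
  have [j tj] := embeddings_complete t.
  by exists j; apply/funext => x; rewrite -tj.
by split; [exact: embedding_zmod_morphism|exact: embedding_monoid_morphism].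
Qed.

Lemma embeddings_conj (s : F -> R[i]) : embeddings s -> embeddings (fun x => conjc (s x)).
Proof.
move=> [sD [s1 sM]]; split=> [x y|]; first by rewrite sD rmorphB.
by split=> [|x y]; rewrite ?s1 ?sM ?rmorph1 ?rmorphM.
Qed.

Definition conj_index j : 'I_n :=
  sval (cid ((embeddingsP _).1 (embeddings_conj ((embeddingsP _).2 (ex_intro _ j erefl))))).

Lemma conj_indexE j : emb (conj_index j) = (fun x => conjc (emb j x)).
Proof. by rewrite /conj_index; case: cid. Qed.

Lemma conj_indexK : involutive conj_index.
Proof.
move=> j; apply: (@embedding_inj F R[i]).
by rewrite !conj_indexE; apply/funext => x; rewrite conjcK.
Qed.

Definition real_index j := `[< is_real_embedding (emb j) >].
Definition chosen_index j := `[< chosen C (emb j) >].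

Lemma real_conj_index j : real_index (conj_index j) = real_index j.
Proof.
apply/asboolP/asboolP => re x; have := re x; rewrite conj_indexE;
  case: (emb j x) => a b /=; first by move/eqP; rewrite oppr_eq0 => /eqP.
by move=> ->; rewrite oppr0.
Qed.

Lemma chosen_indexN j : chosen_index j -> ~~ real_index j.
Proof. by move=> /asboolP/chosen_complex[_ nr]; apply/asboolP. Qed.

Lemma chosen_conj_index j : ~~ real_index j ->
  chosen_index (conj_index j) = ~~ chosen_index j.
Proof.
move=> /asboolP nr; have cj : complex_embeddings (emb j).
  by split => //; apply/embeddingsP; exists j.
have := chosen_conj C cj; rewrite -conj_indexE => chE.
by rewrite /chosen_index (asbool_equiv_eq chE) asbool_neg negbK.
Qed.

Lemma infinite_primesP j :
  infinite_primes C (emb j) <-> real_index j || chosen_index j.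
Proof.
split=> [[[_ re]|ch]|/orP[/asboolP re|/asboolP ch]].
- by apply/orP; left; apply/asboolP.
- by apply/orP; right; apply/asboolP.
- by left; split => //; apply/embeddingsP; exists j.
- by right.
Qed.

(** Moves sums from the infinite primes to indices of embeddings, on which complex conjugation is a
    permutation. *)
Lemma infinite_primes_sum (Q : set (F -> R[i])) (G : infinite_primes C -> R)
    (g : 'I_n -> R) : (forall (s : infinite_primes C) j, val s = emb j -> G s = g j) ->
  \sum_(s \in [set s : infinite_primes C | Q (val s)]) G s =
  \sum_(j | (real_index j || chosen_index j) && `[< Q (emb j) >]) g j.
Proof.
move=> Gg.
have exi (s : infinite_primes C) : exists j, val s = emb j.
  by apply/embeddingsP; case: (set_valP s) => [[]//|/chosen_complex[]].
pose h s := sval (cid (exi s)).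
have hE s : val s = emb (h s) by rewrite /h; case: cid.
rewrite (bigfs _ (r := index_enum 'I_n)); last 2 first.
- exact: index_enum_uniq.
- by move=> i _; rewrite mem_index_enum.
rewrite (reindex_fsbig h [set s | Q (val s)]).
  by apply: eq_fsbigr => s _; exact: Gg.
split=> [s /= Qs|s t _ _ e|j /= /andP[ij /asboolP Qj]].
- have := set_valP s; rewrite hE => /infinite_primesP hs; apply/andP; split=> //.
  by apply/asboolP; rewrite -hE.
- by apply: val_inj; rewrite !hE e.
- have /mem_set Cj := (infinite_primesP j).2 ij.
  exists (SigSub Cj) => //.
  by apply: (@embedding_inj F R[i]); rewrite -hE.
Qed.

(** Conjugation pairs each chosen embedding with an unchosen one of equal value, whence the factor
    2. *)
Lemma sum_conj_index (u v : 'I_n -> R) :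
  \sum_j (if real_index j then u j
          else if chosen_index j then v j else v (conj_index j)) =
  \sum_(j | real_index j) u j + \sum_(j | chosen_index j) 2 * v j.
Proof.
rewrite (bigID real_index) /=; congr (_ + _).
  by apply: eq_bigr => j ->.
rewrite (bigID chosen_index) /= [X in _ + X](reindex_inj (inv_inj conj_indexK)) /=.
rewrite (eq_bigl chosen_index); last first.
  by move=> j /=; case: (boolP (chosen_index j)) => [/chosen_indexN ->|]; rewrite ?andbF.
rewrite [X in _ + X](eq_bigl chosen_index); last first.
  move=> j /=; rewrite real_conj_index.
  have [re|nre] := boolP (real_index j).
    by apply/esym/negbTE; apply: contraL re; exact: chosen_indexN.
  by rewrite chosen_conj_index // negbK.
rewrite -big_split /=; apply: eq_bigr => j cj.
rewrite real_conj_index (negbTE (chosen_indexN cj)) cj.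
by rewrite chosen_conj_index ?chosen_indexN // cj /= conj_indexK mulr2n mulrDl !mul1r.
Qed.

Lemma abs_conj_index j x : abs (emb (conj_index j) x) = abs (emb j x).
Proof. by rewrite conj_indexE; case: (emb j x) => a b /=; rewrite sqrrN. Qed.

Lemma abs_norm (x : F) : \prod_j abs (emb j x) = `|ratr (norm x)|.
Proof.
rewrite -(big_morph _ (@Normc.normcM R) (@Normc.normc1 R)) -norm_embedding.
rewrite -(fmorph_eq_rat (@real_complex R \o ratr)) /=.
by rewrite expr0n addr0 sqrtr_sqr.
Qed.

Variable D : arakelov_divisor C.

Lemma inf_coef_index : exists x : 'I_n -> R,
  forall (s : infinite_primes C) j, val s = emb j -> inf_coef D s = x j.
Proof.
suff [x xP] : {x : 'I_n -> R & forall j (s : infinite_primes C),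
    val s = emb j -> inf_coef D s = x j} by exists x => s j; exact: xP.
apply: (@choice _ _ (fun j y => forall s : infinite_primes C,
  val s = emb j -> inf_coef D s = y)) => j.
have [[s sj]|ns] := pselect (exists s : infinite_primes C, val s = emb j).
  exists (inf_coef D s) => t tj; congr (inf_coef D _).
  by apply: val_inj; rewrite sj.
by exists 0 => s sj; case: ns; exists s.
Qed.

(** The factor 2 at a complex prime is spread over both embeddings of the pair, each of weight
    e^(-x). A real prime has weight e^(-2x), so every infinite prime contributes e^(-2x) to the
    product. *)
Lemma sqnorm_weights : exists a : 'I_n -> R, [/\ forall j, 0 < a j,
  \prod_j a j = expR (- (2 * \sum_(s \in [set: infinite_primes C]) inf_coef D s)) &
  forall f, sqnorm D f = \sum_j abs (emb j f) ^+ 2 * a j].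
Proof.
have [x xE] := inf_coef_index.
pose a j := expR (- (if real_index j then 2 * x j
  else if chosen_index j then x j else x (conj_index j))).
exists a; split=> [j||f]; first exact: expR_gt0.
  rewrite -expR_sum sumrN sum_conj_index; congr (expR (- _)).
  have -> : [set: infinite_primes C] = [set s | setT (val s)] by [].
  rewrite (infinite_primes_sum _ xE) mulr_sumr [RHS](bigID real_index) /=.
  congr (_ + _); apply: eq_bigl => j.
    by rewrite asboolT // andbT; case: (real_index j); rewrite ?andbF.
  rewrite asboolT // andbT; have := @chosen_indexN j.
  by case: (real_index j); case: (chosen_index j) => // /(_ isT).
rewrite /sqnorm.
rewrite (@infinite_primes_sum (@is_real_embedding R F) _
  (fun j => abs (emb j f) ^+ 2 * expR (- (2 * x j)))); last first.
  by move=> s j sj; rewrite sj (xE _ _ sj).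
rewrite (@infinite_primes_sum (fun s => ~ is_real_embedding s) _
  (fun j => 2 * abs (emb j f) ^+ 2 * expR (- x j))); last first.
  by move=> s j sj; rewrite sj (xE _ _ sj).
transitivity (\sum_j (if real_index j then abs (emb j f) ^+ 2 * expR (- (2 * x j))
    else if chosen_index j then abs (emb j f) ^+ 2 * expR (- x j)
    else abs (emb (conj_index j) f) ^+ 2 * expR (- x (conj_index j)))).
  rewrite (sum_conj_index _ (fun j => abs (emb j f) ^+ 2 * expR (- x j))).
  congr (_ + _).
    by apply: eq_bigl => j; rewrite -/(real_index j); case: (real_index j); rewrite ?andbF.
  under [RHS]eq_bigr do rewrite mulrA.
  apply: eq_bigl => j; rewrite asbool_neg -/(real_index j).
  have := @chosen_indexN j.
  by case: (real_index j); case: (chosen_index j) => // /(_ isT).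
apply: eq_bigr => j _; rewrite /a abs_conj_index.
by case: ifP => // _; case: ifP.
Qed.

(** In AM-GM the product of the n terms is |N(f)|^2 e^(-2 sum x_sigma), which [norm_ge_divisor]
    bounds below by e^(-2 deg D). *)
Lemma sqnorm_ge f : colon_ideal D f -> f != 0 ->
  n%:R * expR (- (2 / n%:R * degree D)) <= sqnorm D f.
Proof.
move=> If f0; have [a [a0 aP ->]] := sqnorm_weights.
have n0 : 0 < n%:R :> R by rewrite ltr0n adim_gt0.
rewrite mulrC -ler_pdivlMr //.
have E0 j : 0 <= abs (emb j f) ^+ 2 * a j by rewrite mulr_ge0 ?sqr_ge0 // ltW.
have := (leif_AGM (fun j (_ : j \in 'I_n) => E0 j)).1.
rewrite card_ord (eq_bigl xpredT) // [in X in _ <= X](eq_bigl xpredT) //.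
rewrite big_split prodrXl abs_norm aP /= => agm.
rewrite -(@ler_pXn2r _ n) ?adim_gt0 ?nnegrE ?expR_ge0 //; last first.
  by rewrite divr_ge0 ?ler0n // sumr_ge0.
apply: le_trans agm.
rewrite -expRM_natr mulNr mulrAC divfK ?gt_eqF // /degree mulrDr opprD expRD.
rewrite ler_pM2r ?expR_gt0 //.
rewrite mulrC -mulNr expRM_natr ler_pXn2r ?nnegrE ?expR_ge0 //.
by rewrite -ratr_norm; exact: norm_ge_divisor.
Qed.

End InfinitePrimes.

(** * Packing *)

Section Packing.
Local Open Scope classical_set_scope.
Variables (R : realType) (I : finType) (c : R).
Hypothesis c0 : 0 < c.

(** The mesh of the grid is 1/k; this k makes the squared diameter #|I| / k^2 of a cell less than
    1. *)
Let k := #|I|.+1.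
Let r : R := expR (- (c / k%:R)).

(** One factor per coordinate: two signs, each with a geometric series of first term e^c and ratio
    r. *)
Definition packing_bound : R := (2 * (expR c / (1 - r))) ^+ #|I|.

Let k0 : 0 < k%:R :> R. Proof. by rewrite ltr0n. Qed.

Let r0 : 0 <= r. Proof. exact: expR_ge0. Qed.

Let r1 : r < 1. Proof. by rewrite expR_lt1 oppr_lt0 divr_gt0. Qed.

Let cell (t : R) : bool * nat := (0 <= t, Num.truncn (k%:R * `|t|)).

Let cell_close (t u : R) : cell t = cell u -> (t - u) ^+ 2 <= (k%:R ^- 2).
Proof.
have kt (v : R) : 0 <= k%:R * `|v| by rewrite mulr_ge0 // ltW.
have := truncn_itv (kt t); have := truncn_itv (kt u).
rewrite /cell => /andP[u1 u2] /andP[t1 t2] [sg e]; rewrite e in t1 t2.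
have : `|k%:R * `|t| - k%:R * `|u| | <= 1.
  rewrite -natr1 in t2 u2; rewrite ler_norml; apply/andP; split; lra.
have -> : k%:R * `|t| - k%:R * `|u| = k%:R * (`|t| - `|u|) by rewrite mulrBr.
rewrite normrM [X in X * _]gtr0_norm // -ler_pdivlMl // mulr1 => h.
have {}h : `|t - u| <= k%:R^-1.
  move: sg h; case: (ger0P t) => _; case: (ger0P u) => // _ _.
  by rewrite -opprD normrN.
by rewrite -real_normK ?num_real // -exprVn ler_pXn2r ?nnegrE // invr_ge0 ltW.
Qed.

(** From t^2 >= |t| - 1 and |t| >= m/k for the cell number m, the Gaussian is dominated by a
    geometric term. *)
Let cell_weight (t : R) : expR (- (c * t ^+ 2)) <= expR c * r ^+ (cell t).2.
Proof.
have kt : 0 <= k%:R * `|t| by rewrite mulr_ge0 // ltW.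
have /andP[h _] := truncn_itv kt.
rewrite -expRM_natr -expRD ler_expR /=.
have h' : (cell t).2%:R / k%:R <= `|t| by rewrite ler_pdivrMr // mulrC.
have sq : `|t| - 1 <= t ^+ 2.
  rewrite -[t ^+ 2]real_normK ?num_real //; have := sqr_ge0 (`|t| - 1); nra.
have : c * ((cell t).2%:R / k%:R - 1) <= c * t ^+ 2.
  by rewrite ler_pM2l //; apply: le_trans sq; lra.
rewrite mulrBr mulr1 => H; rewrite -mulNr; lra.
Qed.

(* Points at mutual distance at least 1 lie in distinct cells of a grid. *)
Lemma packing_sum (T : choiceType) (X : seq T) (y : T -> I -> R) : uniq X ->
  {in X &, forall f g, f != g -> 1 <= \sum_i (y f i - y g i) ^+ 2} ->
  \sum_(f <- X) expR (- (c * \sum_i y f i ^+ 2)) <= packing_bound.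
Proof.
move=> uX sep.
(* N exceeds every cell number that occurs, so the codes form a finite type. *)
pose N := (\max_(f <- X) \max_i (cell (y f i)).2).+1.
have ltN f i : f \in X -> ((cell (y f i)).2 < N)%N.
  move=> fX; rewrite ltnS.
  apply: (leq_trans (bigop.leq_bigmax (F := fun i => (cell (y f i)).2) i)).
  exact: (@bigop.leq_bigmax_seq _ X xpredT (fun f => \max_i (cell (y f i)).2)%N).
pose code f : {ffun I -> bool * 'I_N} :=
  [ffun i => ((cell (y f i)).1, inord (cell (y f i)).2)].
have codeE f g i : f \in X -> g \in X -> code f = code g -> cell (y f i) = cell (y g i).
  move=> fX gX /ffunP/(_ i); rewrite !ffunE.
  rewrite [cell (y f i)]surjective_pairing [cell (y g i)]surjective_pairing /=.
  by case=> -> /(congr1 (@nat_of_ord _)); rewrite !inordK ?ltN // => ->.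
have code_inj : {in X &, injective code}.
  move=> f g fX gX e; apply/eqP; apply: contraT => /sep => /(_ fX gX).
  rewrite leNgt => /negP[]; apply: le_lt_trans (ler_sum _ (fun i _ =>
    cell_close (codeE f g i fX gX e))) _.
  rewrite sumr_const -[_ *+ _]mulr_natl ltr_pdivrMr ?exprn_gt0 // mul1r -natrX ltr_nat.
  by rewrite (@leq_trans k) // leq_pmulr.
pose w (p : bool * 'I_N) : R := expR c * r ^+ p.2.
have w0 p : 0 <= w p by rewrite mulr_ge0 ?expR_ge0 ?exprn_ge0.
have le1 : \sum_(f <- X) expR (- (c * \sum_i y f i ^+ 2)) <=
    \sum_(f <- X) \prod_i w (code f i).
  rewrite !big_seq; apply: ler_sum => f fX.
  rewrite mulr_sumr -sumrN expR_sum; apply: ler_prod => i _.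
  by rewrite expR_ge0 /w ffunE /= inordK ?ltN //= cell_weight.
apply: le_trans le1 _.
rewrite -(big_map code xpredT (fun p => \prod_i w (p i))).
have uc : uniq (map code X) by rewrite map_inj_in_uniq.
rewrite big_uniq //=.
have -> : packing_bound = \prod_(i : I) (2 * (expR c / (1 - r))).
  by rewrite prodr_const.
(* The sum over the codes of X is extended to all codes, where it factors into sums over one
   coordinate. *)
apply: le_trans (_ : \prod_(i : I) \sum_(p : bool * 'I_N) w p <= _); last first.
  apply: ler_prod => i _; rewrite sumr_ge0 //=.
  have geom : \sum_(l < N) expR c * r ^+ l <= expR c / (1 - r).
    rewrite -mulr_sumr ler_pM2l ?expR_gt0 // -[X in _ <= X]mul1r.
    rewrite ler_pdivlMr ?subr_gt0 // mulrC -[1 - r]opprB mulNr -subrX1 opprB.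
    by rewrite gerBl exprn_ge0.
  rewrite -(pair_big xpredT xpredT (fun b l => w (b, l))) /= big_bool /w /=.
  by rewrite mulr_natl mulr2n lerD.
rewrite bigA_distr_bigA /=.
rewrite [X in _ <= X](bigID (mem (map code X))) /= lerDl.
by apply: sumr_ge0 => p _; apply: prodr_ge0.
Qed.

End Packing.

(** * The sum over the nonzero elements of the ideal, and the theorem *)

Section ThetaSum.
Local Open Scope classical_set_scope.
Variables (R : realType) (F : fieldExtType rat) (C : conjugate_choice R F).
Variable D : arakelov_divisor C.
Notation n := (\dim {:F}).
Notation emb := (embedding R[i]).

Definition min_sqnorm (d : R) : R := n%:R * expR (- (2 / n%:R * d)).

Lemma min_sqnorm_gt0 d : 0 < min_sqnorm d.
Proof. by rewrite mulr_gt0 ?expR_gt0 // ltr0n adim_gt0. Qed.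

Lemma min_sqnorm_le d e : d <= e -> min_sqnorm e <= min_sqnorm d.
Proof.
by move=> de; rewrite ler_wpM2l ?ler0n // ler_expR lerN2 ler_wpM2l.
Qed.

Lemma sqnorm0 : sqnorm D 0 = 0.
Proof.
have [a [_ _ ->]] := sqnorm_weights D; rewrite big1 // => j _.
by rewrite rmorph0 Normc.normc0 expr0n mul0r.
Qed.

(* In the coordinates scaled by the minimal norm l the nonzero vectors have
   length at least 1, and l (|v|^2 - 1) >= l0 (|v|^2 - 1). *)
Lemma theta_sum_le (d : R) (X : seq F) : degree D <= d -> uniq X ->
  {in X, forall f, divisor_ideal D f /\ f != 0} ->
  \sum_(f <- X) expR (- (pi * sqnorm D f)) <=
  expR (pi * min_sqnorm d) *
    packing_bound ('I_n * bool)%type (pi * min_sqnorm d) *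
  expR (- (pi * min_sqnorm (degree D))).
Proof.
move=> Dd uX XI; set l := min_sqnorm (degree D); set l0 := min_sqnorm d.
have l_gt0 : 0 < l := min_sqnorm_gt0 _; have l0_gt0 : 0 < l0 := min_sqnorm_gt0 _.
have ll : l0 <= l by exact: min_sqnorm_le.
have [a [a0 _ aE]] := sqnorm_weights D.
(* Real and imaginary parts of all embeddings, weighted so that the squared Euclidean length is
   |f|_D^2 / l. *)
pose y f (p : 'I_n * bool) : R :=
  (if p.2 then complex.Re (emb p.1 f) else complex.Im (emb p.1 f)) *
    Num.sqrt (a p.1 / l).
have yB f g p : y f p - y g p = y (f - g) p.
  rewrite /y -mulrBl rmorphB.
  by case: (p.2); rewrite raddfB.
have yE f : \sum_p y f p ^+ 2 = sqnorm D f / l.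
  rewrite -(pair_bigA _ (fun j b => y f (j, b) ^+ 2)) /= aE mulr_suml.
  apply: eq_bigr => j _; rewrite big_bool /y /= !exprMn -mulrDl.
  rewrite sqr_sqrtr ?divr_ge0 ?ltW // mulrA; congr (_ * _ / _).
  by case: (emb j f) => u v /=; rewrite sqr_sqrtr // addr_ge0 ?sqr_ge0.
have lX f : colon_ideal D f -> f != 0 -> l <= sqnorm D f by exact: sqnorm_ge.
have sep : {in X &, forall f g, f != g -> 1 <= \sum_p (y f p - y g p) ^+ 2}.
  move=> f g fX gX fg; under eq_bigr => p _ do rewrite yB.
  rewrite yE ler_pdivlMr // mul1r; apply: lX; last by rewrite subr_eq0.
  have [[If _] [Ig _]] := (XI f fX, XI g gX).
  by apply: (subgroup_colon D).2; exact: divisor_colon.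
have := packing_sum (mulr_gt0 (pi_gt0 R) l0_gt0) uX sep.
set B := packing_bound _ _ => le1.
rewrite -mulrA [B * _]mulrC mulrA.
apply: le_trans (_ : \sum_(f <- X) expR (pi * l0) * expR (- (pi * l)) *
    expR (- (pi * l0 * \sum_p y f p ^+ 2)) <= _); last first.
  by rewrite -mulr_sumr ler_pM2l // mulr_gt0 ?expR_gt0.
rewrite !big_seq; apply: ler_sum => f /XI[If f0].
have lf := lX _ (divisor_colon If) f0.
rewrite yE -!expRD ler_expR.
have -> : pi * l0 - pi * l - pi * l0 * (sqnorm D f / l) =
  - (pi * sqnorm D f) + pi * ((l - l0) * (sqnorm D f / l - 1)).
  by field; rewrite gt_eqF.
rewrite lerDl mulr_ge0 ?pi_ge0 // mulr_ge0 // subr_ge0 //.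
by rewrite ler_pdivlMr // mul1r.
Qed.

Lemma theta_sum_esum_le (d : R) : degree D <= d ->
  (\esum_(f in divisor_ideal D `&` ~` [set 0%R])
     (expR (- (pi * sqnorm D f)))%:E <=
  (expR (pi * min_sqnorm d) *
    packing_bound ('I_n * bool)%type (pi * min_sqnorm d) *
  expR (- (pi * min_sqnorm (degree D))))%:E)%E.
Proof.
move=> Dd; apply: ge_ereal_sup => _ [X [finX XI] <-].
rewrite fsbig_finite // sumEFin lee_fin.
apply: theta_sum_le Dd (fset_uniq _) _ => f.
rewrite in_fset_set // => /set_mem/XI[If /= /eqP]; by split.
Qed.

Lemma k0_split : k0 D = (1%:E + \esum_(f in divisor_ideal D `&` ~` [set 0%R])
  (expR (- (pi * sqnorm D f)))%:E)%E.
Proof.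
rewrite /k0 (esumID [set 0%R]); last by move=> f _; rewrite lee_fin expR_ge0.
congr (_ + _)%E; rewrite (_ : _ `&` _ = [set 0%R]).
  by rewrite esum_set1 ?sqnorm0 ?mulr0 ?oppr0 ?expR0 // lee_fin expR_ge0.
apply/seteqP; split=> [f [//]|f -> /=]; split => //; exact: divisor_ideal0.
Qed.

End ThetaSum.

Theorem corollary1 (R : realType) (F : fieldExtType rat) :
  exists beta : R,
    forall (C : conjugate_choice R F) (D : arakelov_divisor C),
      degree D <= 2^-1 * ln `|ratr (discriminant F)| ->
      (h0 D < k0 D - 1%:E)%E /\
      (k0 D - 1%:E <=
         (beta * expR (- (pi * (\dim {:F})%:R *
            expR (- (2 / (\dim {:F})%:R * degree D)))))%:E)%E.
Proof.
set d := 2^-1 * _.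
(* This depends on n and the degree bound d alone, as [theta_sum_esum_le] is uniform in D. *)
exists (expR (pi * min_sqnorm F d) *
  packing_bound ('I_(\dim {:F}) * bool)%type (pi * min_sqnorm F d)).
move=> C D Dd; have := theta_sum_esum_le Dd.
rewrite /h0 k0_split -[pi * _ * expR _]mulrA -/(min_sqnorm F (degree D)).
set E := esum _ _.
have E_gt0 : (0 < E)%E.
  have [f If f0] := divisor_ideal_nonzero D.
  apply: (@lt_le_trans _ _ (expR (- (pi * sqnorm D f)))%:E).
    by rewrite lte_fin expR_gt0.
  apply: esum_ge; exists [set f]%classic; last by rewrite fsbig_set1.
  by split; [exact: finite_set1|move=> _ ->; split => //; exact/eqP].
(* The upper bound excludes an infinite sum; for finite e the strict inequality is log(1 + e) <
   e. *)
case: E E_gt0 => [e| |] //; rewrite lte_fin => e0 eb.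
rewrite -EFinD -EFinB (_ : 1 + e - 1 = e); last by ring.
split => //.
rewrite lne_EFin ?addr_gt0 // lte_fin -ltr_expR lnK ?posrE ?addr_gt0 //.
by rewrite expR_gt1Dx // gt_eqF.
Qed.
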